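(* Consider the perturbed first-order system $$\dot x(t)=u(t)+\Delta(t),$$ where $x\in\mathbb{R}$ is the state variable, $u\in\mathbb{R}$ is the control input and $\Delta(t)\in\mathbb{R}$ is an unknown but bounded perturbation term satisfying $|\Delta(t)|\le\delta$, with $0\le\delta<\infty$ a known constant. Let $\alpha,\beta,p,q,k>0$, $kp<1$, $kq>1$, $T_c>0$, $\zeta\ge\delta$, and let $$\gamma=\frac{\Gamma(m_p)\,\Gamma(m_q)}{\alpha^{k}\,\Gamma(k)\,(q-p)}\left(\frac{\alpha}{\beta}\right)^{m_p},\qquad m_p=\frac{1-kp}{q-p},\quad m_q=\frac{kq-1}{q-p}.$$ If the control input $u$ is selected as $$u=-\left[\frac{\gamma}{T_c}\left(\alpha|x|^p+\beta|x|^q\right)^k+\zeta\right]\operatorname{sign}(x),$$ then the origin $x=0$ of the system is predefined-time stable with predefined time $T_c$.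
   Context: $\Gamma(z)=\int_0^{+\infty}e^{-t}t^{z-1}\,dt$ is the Gamma function, and $\operatorname{sign}$ is the sign function. Below, $x(t,x_0)$ denotes a solution of the system with initial condition $x(0)=x_0$. Lyapunov stability: the origin is Lyapunov stable if for all $\epsilon>0$ there is $\eta=\eta(\epsilon)>0$ such that for all $\|x_0\|<\eta$, any solution $x(t,x_0)$ exists for all $t\ge 0$ and $\|x(t,x_0)\|<\epsilon$ for all $t\ge 0$. Global finite-time stability: the origin is globally finite-time stable if it is Lyapunov stable and for any $x_0$ there exists $0\le T<+\infty$ such that the solution satisfies $x(t,x_0)=0$ for all $t\ge T$. The settling-time function is $T(x_0)=\inf\{T : x(t,x_0)=0\ \forall t\ge T\}$. Fixed-time stability: the origin is fixed-time stable if it is globally finite-time stable and the settling-time function is bounded, i.e. there exists $T_{\max}>0$ such that $T(x_0)\le T_{\max}$ for all $x_0$. Predefined-time stability: for an arbitrarily selected constant $T_c>0$ (depending on the system parameters), the origin is predefined-time stable if it is fixed-time stable and the settling-time function satisfies $T(x_0)\le T_c$ for all $x_0$; in this case $T_c$ is called a predefined time. *)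

(* Defs.v *)
From HB Require Import structures.
From mathcomp Require Import all_boot all_order all_algebra.
From mathcomp Require Import all_classical all_reals all_analysis.
From mathcomp Require Import measurable_realfun.

Set Implicit Arguments.
Unset Strict Implicit.
Unset Printing Implicit Defensive.

Import Order.TTheory GRing.Theory Num.Theory.
Import numFieldNormedType.Exports.

Local Open Scope classical_set_scope.
Local Open Scope ring_scope.

Section Gamma.
Context {R : realType}.

Definition Gamma (z : R) : R :=
  \int[lebesgue_measure]_(t in `]0, +oo[) (expR (- t) * t `^ (z - 1)).

End Gamma.

Section LebesgueMeasurable.
Context {R : realType}.

(* Preimages of Borel sets are measurable for the completed (Lebesgue)
   sigma-algebra; [measurable_fun] at type [R -> R] would ask for Borel
   preimages. *)
Definition lebesgue_measurable_fun (D : set R) (f : R -> R) : Prop :=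
  @measurable_fun _ _
    (g_sigma_algebraType (completed_algebra_gen (@lebesgue_measure R)))
    (measurableTypeR R) D f.

End LebesgueMeasurable.

Section AbsoluteContinuity.
Context {R : realType}.

Definition abs_continuous (a b : R) (x : R -> R) : Prop :=
  forall e : R, 0 < e -> exists2 d : R, 0 < d &
    forall (n : nat) (u v : 'I_n -> R),
      (forall i, a <= u i /\ u i <= v i /\ v i <= b) ->
      trivIset setT (fun i => `]u i, v i[%classic) ->
      \sum_(i < n) (v i - u i) < d ->
      \sum_(i < n) `|x (v i) - x (u i)| < e.

End AbsoluteContinuity.

Section Filippov.
Context {R : realType}.
Implicit Types (f : R -> R -> R) (x : R -> R) (A C N : set R).

Definition closed_convex_hull A : set R :=
  \bigcap_(C in [set C | [/\ closed C, convex_set (C : set R^o) & A `<=` C]]) C.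

(* Filippov's regularization of the right-hand side of x' = f t x, which may
   be discontinuous in the state. *)
Definition filippov f (t y : R) : set R :=
  \bigcap_(r in [set r | 0 < r])
  \bigcap_(N in [set N | (@lebesgue_measure R).-negligible N])
    closed_convex_hull (f t @` (ball y r `\` N)).

(* Solution on [0, tau[; the values of x outside [0, tau[ are irrelevant. *)
Definition is_solution f (x0 : R) (tau : \bar R) x : Prop :=
  [/\ (0 < tau)%E,
      x 0 = x0,
      forall b : R, 0 <= b -> (b%:E < tau)%E -> abs_continuous 0 b x &
      {ae @lebesgue_measure R, forall t : R, 0 < t -> (t%:E < tau)%E ->
        derivable x t 1 /\ filippov f t (x t) (x^`()%classic t)}].

(* "Any solution from x0 exists for all t >= 0": there is one, and none of them
   blows up, i.e. every solution on [0, tau[ continues to [0, +oo[. *)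
Definition forward_complete f (x0 : R) : Prop :=
  (exists x, is_solution f x0 +oo x) /\
  forall tau x, is_solution f x0 tau x ->
    exists2 y, is_solution f x0 +oo y &
      forall t : R, 0 <= t -> (t%:E < tau)%E -> y t = x t.

End Filippov.

Section Stability.
Context {R : realType}.
Implicit Type f : R -> R -> R.

Definition lyapunov_stable f : Prop :=
  forall e : R, 0 < e -> exists2 eta : R, 0 < eta &
    forall x0, `|x0| < eta ->
      forward_complete f x0 /\
      forall x, is_solution f x0 +oo x -> forall t : R, 0 <= t -> `|x t| < e.

(* Solutions are not assumed unique: T works for all those starting at x0. *)
Definition settled_after f (x0 T : R) : Prop :=
  0 <= T /\
  forall x, is_solution f x0 +oo x -> forall t, T <= t -> x t = 0.

Definition globally_finite_time_stable f : Prop :=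
  lyapunov_stable f /\
  forall x0, forward_complete f x0 /\ exists T, settled_after f x0 T.

Definition settling_time f (x0 : R) : \bar R :=
  ereal_inf [set T%:E | T in settled_after f x0].

Definition fixed_time_stable f : Prop :=
  globally_finite_time_stable f /\
  exists2 Tmax : R, 0 < Tmax & forall x0, (settling_time f x0 <= Tmax%:E)%E.

Definition predefined_time_stable f (Tc : R) : Prop :=
  [/\ 0 < Tc, fixed_time_stable f &
      forall x0, (settling_time f x0 <= Tc%:E)%E].

End Stability.

(* Main.v *)
Require Import Defs.
From HB Require Import structures.
From mathcomp Require Import all_boot all_order all_algebra.
From mathcomp Require Import all_classical all_reals all_analysis.
From mathcomp Require Import measurable_realfun ring lra.

(** The control dominates the perturbation: away from the origin the velocity of
   |x| is at most - g x, where g x is gamma / Tc times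
   (alpha |x|^p + beta |x|^q)^k. Hence |x| is nonincreasing along every solution,
   which gives Lyapunov stability and makes the origin absorbing. The time needed
   to reach the origin is at most the integral of 1 / g over ]0, |x0|[. After the
   substitution r = (beta / alpha) x^(q - p) the integral over the whole half-line
   is a complete Beta integral; gamma is chosen so that it equals Tc
   ([Gamma_beta], [settling_time_function]). A solution that is still away from
   the origin at time Tc would need the time Tc for only a part of that integral
   ([off_zero_solution_reach]).

   Solutions are absolutely continuous and satisfy the differential inclusion only
   almost everywhere, so all comparisons rest on one principle: an absolutely
   continuous function whose derivative is almost everywhere at most c grows at
   rate at most c ([abs_continuous_le], [barrier]). At a point y <> 0 the field is
   continuous in the state and the Filippov set is the single value of the field
   ([filippov_continuous]); at 0 it contains 0 because zeta dominates Delta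
   ([filippov_field0]).

   Existence cannot be read off a Lipschitz condition, because g is only Hoelder
   continuous at 0 and Delta is only measurable. With D a primitive of
   zeta - Delta, the unknown Y = x + D of a nonnegative trajectory solves
   Y' = - g (Y - D), whose right-hand side is continuous and monotone in Y.
   Monotonicity makes the solutions of the equations with delay h converge as h
   tends to 0 ([monotone_ode]). As Y - D is nonincreasing, x = max (Y - D, 0) is a
   trajectory that stops at the origin ([nonneg_trajectory]). Trajectories on the
   negative side are obtained by reflection. Finally, solutions are Lipschitz, so a
   solution on a bounded interval has an end point, from which such a trajectory
   continues it ([solution_extends]). *)

Set Implicit Arguments.
Unset Strict Implicit.
Unset Printing Implicit Defensive.

Import Order.TTheory GRing.Theory Num.Theory.
Import numFieldNormedType.Exports.

Local Open Scope classical_set_scope.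
Local Open Scope ring_scope.

(** * Absolutely continuous functions and differential inequalities *)

Section AlmostEverywhere.
Context {R : realType}.
Local Notation mu := (@lebesgue_measure R).

Lemma ae_impl (P Q : R -> Prop) : (forall t, P t -> Q t) ->
  {ae mu, forall t, P t} -> {ae mu, forall t, Q t}.
Proof. by move=> PQ; apply: negligibleS => t /= nQ /PQ. Qed.

Lemma ae_and (P Q : R -> Prop) : {ae mu, forall t, P t} ->
  {ae mu, forall t, Q t} -> {ae mu, forall t, P t /\ Q t}.
Proof.
move=> aP aQ; apply: negligibleS (negligibleU aP aQ) => t /= nPQ.
by apply/not_andP => -[Pt Qt]; apply: nPQ.
Qed.

Lemma negligible_ae (N : set R) : mu.-negligible N -> {ae mu, forall t, ~ N t}.
Proof. by apply: negligibleS => t /= /contrapT. Qed.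

Lemma negligible_set1 (t : R) : mu.-negligible [set t].
Proof. by apply/negligibleP; [exact: measurable_set1|exact: lebesgue_measure_set1]. Qed.

End AlmostEverywhere.

Section RealInduction.
Context {R : realType}.

(** Continuity method: the supremum of the points of [a, b] that satisfy P is b,
   because the step hypothesis crosses every point of [a, b]. *)
Lemma real_induction (P : R -> Prop) (a b : R) : a <= b -> P a ->
  (forall t, a <= t <= b -> exists2 r, 0 < r &
     forall u v, a <= u <= t -> t <= v <= b -> t - r < u -> v < t + r ->
       P u -> P v) ->
  P b.
Proof.
move=> ab Pa step.
pose S := [set t | a <= t <= b /\ P t].
have Sa : S a by split=> //; lra.
have ubS : ubound S b by move=> t [/andP[]].
have hS : has_sup S by split; [exists a | exists b].
have supb : sup S <= b by apply: ge_sup => //; exists a.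
have asup : a <= sup S by apply: ub_le_sup => //; exists b.
have [r r0 hr] := step (sup S) (introT andP (conj asup supb)).
have [t [/andP[at_ tb] Pt] ht] := sup_adherent r0 hS.
have tsup : t <= sup S by apply: ub_le_sup => //; [exists b | split => //; apply/andP].
have Pnext v : sup S <= v -> v <= b -> v < sup S + r -> P v.
  by move=> h1 h2 h3; apply: (hr t v) => //; apply/andP.
have [bs|sb] := leP b (sup S + r / 2); first by apply: Pnext => //; lra.
have : sup S + r / 2 <= sup S.
  apply: ub_le_sup; first by exists b.
  split; first by apply/andP; split; lra.
  by apply: Pnext; lra.
by lra.
Qed.

End RealInduction.

Section DerivativeEstimates.
Context {R : realType}.
Implicit Types f : R -> R.

(** Differentiability without a quotient, in the form that covering arguments and
   passages to the limit use. *)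
Lemma derivable_linear_approx f (t : R) : derivable f t 1 ->
  forall e, 0 < e -> exists2 r, 0 < r &
    forall z, `|z - t| < r -> `|f z - f t - f^`()%classic t * (z - t)| <= e * `|z - t|.
Proof.
move=> df e e0.
have /cvgrPdist_le /(_ e e0) : h^-1 *: (f (h *: 1 + t) - f t) @[h --> 0^'] --> f^`()%classic t.
  by rewrite derive1E; exact: df.
rewrite near_withinE => /nbhs_ballP[r /= r0 hr].
exists r => // z zt.
have [->|zt0] := eqVneq z t; first by rewrite !subrr mulr0 subrr normr0 mulr0.
have zt1 : z - t != 0 by rewrite subr_eq0.
have := hr (z - t); rewrite /ball/= sub0r normrN => /(_ zt zt1).
rewrite [_%:A]mulr1 subrK => H.
have -> : f z - f t - f^`()%classic t * (z - t) = - ((f^`()%classic t - (z - t)^-1 * (f z - f t)) * (z - t)).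
  by rewrite mulrBl mulrAC mulVf // mul1r opprB.
by rewrite normrN normrM ler_wpM2r.
Qed.

Lemma linear_approx_is_derive f (t l : R) :
  (forall e, 0 < e -> exists2 r, 0 < r &
    forall z, `|z - t| < r -> `|f z - f t - l * (z - t)| <= e * `|z - t|) ->
  is_derive t 1 f l.
Proof.
move=> H.
suff dl : h^-1 *: (f (h *: 1 + t) - f t) @[h --> 0^'] --> l.
  by split; [apply/cvg_ex; exists l | exact/cvg_lim].
apply/cvgrPdist_le => e e0; rewrite near_withinE.
have [r r0 hr] := H e e0.
apply/nbhs_ballP; exists r => //= h; rewrite /ball/= sub0r normrN => hr1 h0.
have := hr (h + t); rewrite addrK => /(_ hr1) H2.
rewrite [h%:A]mulr1.
rewrite -(ler_pM2r (_ : 0 < `|h|)) ?normr_gt0 //; apply: le_trans H2.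
rewrite -normrM -normrN le_eqVlt; apply/orP; left; apply/eqP; congr (`|_|).
by rewrite /GRing.scale/=; field.
Qed.

End DerivativeEstimates.

Section AbsolutelyContinuous.
Context {R : realType}.
Implicit Types f : R -> R.
Local Notation mu := (@lebesgue_measure R).

Lemma abs_continuous_sub f a b c d : a <= c -> d <= b ->
  abs_continuous a b f -> abs_continuous c d f.
Proof.
move=> ac db acf e e0; have [r r0 H] := acf e e0; exists r => // n u v uv.
by apply: H => i; have := uv i; lra.
Qed.

Lemma lipschitz_abs_continuous f (K a b : R) :
  (forall s t, a <= s -> s <= t -> t <= b -> `|f t - f s| <= K * (t - s)) ->
  abs_continuous a b f.
Proof.
move=> lipf e e0.
have K0 : 0 < `|K| + 1 by rewrite ltr_pwDr.
exists (e / (`|K| + 1)); first by rewrite divr_gt0.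
move=> n u v uv _; rewrite ltr_pdivlMr // => H.
apply: le_lt_trans H; rewrite mulr_suml; apply: ler_sum => i _.
have [h1 [h2 h3]] := uv i; apply: le_trans (lipf _ _ h1 h2 h3) _.
rewrite mulrC ler_wpM2l ?subr_ge0 //.
by apply: le_trans (ler_norm K) _; rewrite lerDl.
Qed.

Lemma abs_continuousN f a b :
  abs_continuous a b f -> abs_continuous a b (fun t => - f t).
Proof.
move=> acf e e0; have [d d0 H] := acf e e0.
exists d => // n u v h1 h2 h3.
rewrite (eq_bigr (fun i => `|f (v i) - f (u i)|)); first exact: H.
by move=> i _; rewrite -opprD normrN.
Qed.

Lemma lipschitz_continuous f (K : R) :
  (forall s t, s <= t -> `|f t - f s| <= K * (t - s)) -> continuous f.
Proof.
move=> lipf t; apply/cvgrPdist_lt => e e0.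
have K0 : 0 < `|K| + 1 by rewrite ltr_pwDr.
apply/nbhs_ballP; exists (e / (`|K| + 1)) => /=; first by rewrite divr_gt0.
move=> s; rewrite /ball/= ltr_pdivlMr //; apply: le_lt_trans.
wlog ts : s t / t <= s.
  by move=> H; have [/H//|/ltW/H] := leP t s; rewrite distrC [`|s - t|]distrC.
rewrite distrC [`|t - s|]distrC (ger0_norm (_ : 0 <= s - t)) ?subr_ge0 //.
apply: le_trans (lipf _ _ ts) _; rewrite mulrC ler_wpM2l ?subr_ge0 //.
by apply: le_trans (ler_norm K) _; rewrite lerDl.
Qed.

Lemma abs_continuous_near f a b : abs_continuous a b f ->
  forall e, 0 < e -> exists2 r, 0 < r &
    forall s t, a <= s -> s <= t -> t <= b -> t - s < r -> `|f t - f s| < e.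
Proof.
move=> acf e e0; have [r r0 H] := acf e e0; exists r => // s t as_ st tb tsr.
have := H 1%N (fun=> s) (fun=> t); rewrite !big_ord1; apply=> //.
by apply/trivIsetP => i j _ _; rewrite !ord1 eqxx.
Qed.

Lemma open_cover_small (N : set R) (d : R) : mu.-negligible N -> 0 < d ->
  exists U : set R, [/\ open U, N `<=` U & (mu U < d%:E)%E].
Proof.
move=> [A [mA A0 NA]] d0.
have [|U [oU AU UAd]] := @lebesgue_regularity_outer _ A d mA _ d0.
  by rewrite [X in (X < _)%E]A0 ltry.
exists U; split => //; first exact: subset_trans AU.
rewrite -(setDUK AU); apply: le_lt_trans UAd.
apply: le_trans (measureU2 _ _ _) _ => //.
  by apply: measurableD => //; exact: open_measurable.
by rewrite [X in (X + _)%E](_ : _ = 0%E) ?add0e.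
Qed.

Lemma sum_itv_lt (n : nat) (u v : nat -> R) (U : set R) (d : R) : open U ->
  (forall i, (i < n)%N -> u i <= v i /\ `]u i, v i[ `<=` U) ->
  trivIset `I_n (fun i => `]u i, v i[%classic) ->
  (mu U < d%:E)%E -> \sum_(0 <= i < n) (v i - u i) < d.
Proof.
move=> oU uvU tI Ud.
rewrite -lte_fin; apply: le_lt_trans Ud.
have mI : measurable (\big[setU/set0]_(i < n) (`]u i, v i[%classic : set R)).
  exact: bigsetU_measurable.
rewrite (_ : (_)%:E = mu (\big[setU/set0]_(i < n) `]u i, v i[%classic)); last first.
  rewrite (@measure_semi_additive_ord_I _ _ _ mu (fun i => `]u i, v i[%classic))//= big_mkord -sumEFin; apply: eq_bigr => i _.
  rewrite lebesgue_measure_itv/= lte_fin.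
  have [_|vu] := ltP; first by rewrite EFinB.
  have [uv _] := uvU i (ltn_ord i).
  by congr (_%:E); lra.
apply: le_measure; rewrite ?inE//; first exact: open_measurable.
by rewrite -(bigcup_mkord n (fun i => `]u i, v i[%classic)) => x [i /= /uvU[_]]; apply.
Qed.

(** Good points contribute at most (c + e) per unit length. The others lie in an
   open set U of small measure: the part of [a, b] covered through them is a finite
   union of disjoint intervals of small total length, on which absolute continuity
   makes the variation of f small. Real induction replaces a covering theorem. *)
Lemma abs_continuous_le f a b c : a <= b -> abs_continuous a b f ->
  {ae mu, forall t, a < t -> t < b -> derivable f t 1 /\ f^`()%classic t <= c} ->
  f b - f a <= c * (b - a).
Proof.
move=> ab acf [N0 [mN0 N00 hN0]].
apply/ler_addgt0Pr => e0 e00.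
pose e := Num.min 1 (e0 / (b - a + 2)).
have ba2 : 0 < b - a + 2 by lra.
have e_gt0 : 0 < e by rewrite lt_min ltr01 divr_gt0.
have e_le1 : e <= 1 by rewrite ge_min lexx.
have e_le : e * (b - a + 2) <= e0 by rewrite -ler_pdivlMr // ge_min lexx orbT.
have [d d0 hd] := acf e e_gt0.
pose d' := Num.min d (e / (`|c| + 1)).
have c1 : 0 < `|c| + 1 by rewrite ltr_pwDr.
have d'0 : 0 < d' by rewrite lt_min d0 divr_gt0.
have [U [oU NU Ud]] : exists U : set R,
    [/\ open U, N0 `|` [set a; b] `<=` U & (mu U < d'%:E)%E].
  apply: open_cover_small => //; apply: negligibleU; first by (exists N0; split).
  by apply: negligibleU; exact: negligible_set1.
(* The estimate on [a, t], before the contribution of the exceptional intervals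
   is known to be small. *)
pose P t := exists n (u v : nat -> R),
  [/\ forall i, (i < n)%N -> [/\ a <= u i, u i <= v i, v i <= t & `]u i, v i[ `<=` U],
      forall i j, (i < j)%N -> (j < n)%N -> v i <= u j &
      f t - f a <= (c + e) * (t - a) +
        \sum_(0 <= i < n) (`|f (v i) - f (u i)| + (`|c| + 1) * (v i - u i))].
have : P b.
  apply: (@real_induction _ P a b) => //.
    by exists 0%N, (fun=> 0), (fun=> 0); split=> //; rewrite big_nil !subrr mulr0 addr0.
  move=> t /andP[at_ tb].
  have [Ut|nUt] := pselect (U t).
    (* Near t the whole step is recorded as one more exceptional interval. *)
    have /nbhs_ballP[r /= r0 hr] : nbhs t U by exact: open_nbhs_nbhs.
    exists r => // u v /andP[au ut] /andP[tv vb] tru vtr [n [uu [vv [h1 h2 h3]]]].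
    exists n.+1, (fun i => if i == n then u else uu i),
      (fun i => if i == n then v else vv i); split.
    - move=> i; rewrite ltnS leq_eqVlt; case: eqP => [_ _|_ /= /h1[? ? ? ?]].
        split; [lra|lra|lra|]; move=> x /=; rewrite in_itv/= => /andP[ux xv].
        by apply: hr; rewrite /ball/= ltr_norml; lra.
      by split => //; lra.
    - move=> i j ij; rewrite ltnS => jn.
      rewrite (ltn_eqF (leq_trans ij jn)); move: jn; rewrite leq_eqVlt; case: eqP => [jn _|_ /= jn]; last exact: h2.
      by rewrite jn in ij; have [_ _ vu _] := h1 _ ij.
    - rewrite big_nat_recr//= eqxx.
      rewrite (eq_big_nat _ _ (F2 := fun i => `|f (vv i) - f (uu i)| + (`|c| + 1) * (vv i - uu i))); last first.
        by move=> i /andP[_ ii]; rewrite ltn_eqF.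
      have h4 := ler_norm (f v - f u).
      have h5 : - (`|c| + 1) <= c + e by have := ler_norm (- c); rewrite normrN; lra.
      have : - (`|c| + 1) * (v - u) <= (c + e) * (v - u) by rewrite ler_wpM2r//; lra.
      by lra.
  have nab : t <> a /\ t <> b.
    by split=> tE; apply: nUt; apply: NU; rewrite tE; right; [left|right].
  have [dt ct] : derivable f t 1 /\ f^`()%classic t <= c.
    have [//|nH] := pselect (derivable f t 1 /\ f^`()%classic t <= c).
    exfalso; apply: nUt; apply: NU; left; apply: hN0 => /= H; apply: nH.
    by apply: H; rewrite lt_neqAle; apply/andP; split => //; apply/eqP => //; case: nab => ? ?; congruence.
  have [r r0 hr] := derivable_linear_approx dt e_gt0.
  exists r => // u v /andP[au ut] /andP[tv vb] tru vtr [n [uu [vv [h1 h2 h3]]]].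
  exists n, uu, vv; split => //.
    by move=> i /h1[? ? ? ?]; split => //; lra.
  have hu : `|u - t| < r by rewrite ltr_norml; lra.
  have hv : `|v - t| < r by rewrite ltr_norml; lra.
  have := hr u hu; have := hr v hv.
  rewrite [`|u - t|]ler0_norm ?[`|v - t|]ger0_norm; [|lra|lra].
  rewrite !ler_norml => /andP[_ h4] /andP[h5 _].
  have : f^`()%classic t * (v - u) <= c * (v - u) by rewrite ler_wpM2r//; lra.
  by lra.
move=> [n [u [v [h1 h2 h3]]]].
have tI : trivIset `I_n (fun i => `]u i, v i[%classic).
  apply/trivIsetP => i j /= ii jj ij; apply/seteqP; split => // x [] /=.
  rewrite !in_itv/= => /andP[x1 x2] /andP[x3 x4].
  have /orP[/h2/(_ jj)|/h2/(_ ii)] : (i < j)%N || (j < i)%N by rewrite -neq_ltn.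
    by lra.
  by lra.
have sd : \sum_(0 <= i < n) (v i - u i) < d'.
  by apply: (sum_itv_lt oU) => // i /h1[].
have se : \sum_(0 <= i < n) `|f (v i) - f (u i)| < e.
  rewrite big_mkord; apply: (hd n (fun i => u i) (fun i => v i)).
  - by move=> i; have [] := h1 i (ltn_ord i).
  - apply/trivIsetP => i j _ _ ij; move/trivIsetP : tI; apply => //=.
  - by rewrite -(big_mkord xpredT (fun i => v i - u i)); apply: lt_le_trans sd _; rewrite ge_min lexx.
rewrite big_split/= -mulr_sumr in h3.
have : (`|c| + 1) * \sum_(0 <= i < n) (v i - u i) <= e.
  rewrite mulrC -ler_pdivlMr //; apply: ltW; apply: lt_le_trans sd _.
  by rewrite ge_min lexx orbT.
by lra.
Qed.

(** After its last visit to the region below m, f would have to climb above m with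
   a nonpositive derivative. *)
Lemma barrier f a b m : a <= b -> abs_continuous a b f -> f a <= m ->
  {ae mu, forall t, a < t -> t < b -> m < f t ->
     derivable f t 1 /\ f^`()%classic t <= 0} ->
  f b <= m.
Proof.
move=> ab acf fam aef.
pose S := [set t | a <= t <= b /\ f t <= m].
have Sa : S a by split=> //; lra.
have ubS : ubound S b by move=> t [/andP[]].
have hS : has_sup S by split; [exists a | exists b].
have sb : sup S <= b by apply: ge_sup => //; exists a.
have as_ : a <= sup S by apply: ub_le_sup => //; exists b.
have fs : f (sup S) <= m.
  apply/ler_addgt0Pr => e e0.
  have [r r0 hr] := abs_continuous_near acf e0.
  have [t [/andP[at_ tb] ft] rt] := sup_adherent r0 hS.
  have ts : t <= sup S by apply: ub_le_sup; [exists b | split => //; lra].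
  have := hr _ _ at_ ts sb; rewrite ltr_norml => /(_ _)/andP; case; first lra.
  by lra.
have gtS t : sup S < t -> t < b -> m < f t.
  move=> st tb; rewrite ltNge; apply/negP => ft.
  suff : t <= sup S by lra.
  by apply: ub_le_sup; [exists b | split => //; lra].
have := @abs_continuous_le f (sup S) b 0 sb (abs_continuous_sub as_ (lexx b) acf).
rewrite mul0r; move=> H; suff : f b - f (sup S) <= 0 by lra.
apply: H; apply: ae_impl aef => t H st tb; apply: H => //; first lra.
exact: gtS.
Qed.

End AbsolutelyContinuous.

(** * Primitives of bounded measurable functions *)

Section Primitive.
Context {R : realType}.
Local Notation mu := (@lebesgue_measure R).
Implicit Types (phi psi : R -> R) (s t : R).

Definition primitive phi (t : R) : R := \int[mu]_(s in `[0, t]) phi s.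

Lemma eq_primitive phi psi t : (forall s, s <= t -> phi s = psi s) ->
  primitive phi t = primitive psi t.
Proof.
move=> H; apply: eq_Rintegral => s; rewrite inE/= in_itv/= => /andP[_ st].
exact: H.
Qed.

Lemma primitive_le0 phi t : t <= 0 -> primitive phi t = 0.
Proof.
rewrite le_eqVlt => /orP[/eqP ->|t0]; first by rewrite /primitive set_itv1 Rintegral_set1.
by rewrite /primitive set_itv_ge ?Rintegral_set0// bnd_simp -ltNge.
Qed.

Lemma itv_measure_lty (b1 b2 : bool) (s t : R) :
  (mu [set` Interval (BSide b1 s) (BSide b2 t)] < +oo)%E.
Proof. by rewrite lebesgue_measure_itv/=; case: ifPn => // _; rewrite -EFinB ltry. Qed.

Lemma itv_measureE (b1 b2 : bool) (s t : R) : s <= t ->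
  mu [set` Interval (BSide b1 s) (BSide b2 t)] = (t - s)%:E.
Proof.
move=> st; rewrite lebesgue_measure_itv/= lte_fin; case: ltP => [_|ts].
  by rewrite EFinB.
by congr (_%:E); lra.
Qed.

Section Bounded.
Variables (phi : R -> R) (M : R).
Hypotheses (mphi : measurable_fun setT phi) (phi_bnd : forall t, 0 <= phi t <= M).

Lemma bounded_itv_integrable (b1 b2 : bool) (s t : R) :
  mu.-integrable [set` Interval (BSide b1 s) (BSide b2 t)] (EFin \o phi).
Proof.
apply: measurable_bounded_integrable => //.
- exact: itv_measure_lty.
- exact: measurable_funTS.
- exists M; split; first exact: num_real.
  move=> x Mx y _ /=; have := phi_bnd y; rewrite ger0_norm; first lra.
  by case/andP: (phi_bnd y).
Qed.

Lemma primitive_diff s t : s <= t ->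
  0 <= primitive phi t - primitive phi s <= M * (t - s).
Proof.
have M0 : 0 <= M by have := phi_bnd 0; lra.
have key a b : 0 <= a -> a <= b ->
    0 <= primitive phi b - primitive phi a <= M * (b - a).
  move=> a0 ab.
  rewrite /primitive (@Rintegral_itvB _ _ (BLeft 0) (BRight b)); last 3 first.
  - exact: bounded_itv_integrable.
  - by rewrite bnd_simp.
  - by rewrite bnd_simp.
  apply/andP; split; first by apply: Rintegral_ge0 => x _; case/andP: (phi_bnd x).
  apply: le_trans (@le_Rintegral _ _ _ mu _ phi (fun=> M) _ _ _ _) _ => //.
  - exact: bounded_itv_integrable.
  - apply: measurable_bounded_integrable => //.
      exact: itv_measure_lty.
    by exists M; split; [exact: num_real|move=> x Mx y _ /=; rewrite ger0_norm// ltW].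
  - by move=> x _; case/andP: (phi_bnd x).
  rewrite Rintegral_cst// ler_wpM2l //.
  have /(congr1 fine)/= E := itv_measureE false false ab.
  by rewrite -[leRHS]E.
move=> st.
have [s0|s0] := leP 0 s; first exact: key.
rewrite (primitive_le0 _ (ltW s0)) subr0.
have [t0|t0] := leP 0 t; last first.
  by rewrite (primitive_le0 _ (ltW t0)) lexx mulr_ge0//; lra.
have := key 0 t (lexx 0) t0; rewrite (primitive_le0 _ (lexx 0)) !subr0 => /andP[-> H] /=.
by apply: le_trans H _; rewrite ler_wpM2l//; lra.
Qed.

Lemma primitive_derive_continuous t : 0 < t -> {for t, continuous phi} ->
  is_derive t 1 (primitive phi) (phi t).
Proof.
move=> t0 ct.
have t1 : t < t + 1 by lra.
have [d1 d2] := @continuous_FTC1_closed _ phi 0 t (t + 1) t1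
  (bounded_itv_integrable true false 0 (t + 1)) t0 ct.
by split; [exact: d1|rewrite -derive1E; exact: d2].
Qed.

Lemma primitive_derive_ae :
  {ae mu, forall t, 0 < t -> is_derive t 1 (primitive phi) (phi t)}.
Proof.
have M0 : 0 <= M by have := phi_bnd 0; lra.
have L : locally_integrable setT phi.
  split => //; first exact: openT.
  move=> K _ cK.
  apply: (@le_lt_trans _ _ (\int[mu]_(x in K) M%:E)%E); last first.
    rewrite integral_cst//=; last exact: compact_measurable.
    by rewrite lte_mul_pinfty//; exact: compact_finite_measure.
  apply: ge0_le_integral => //=.
  - exact: compact_measurable.
  - by apply/measurable_EFinP; apply: measurableT_comp => //; exact: measurable_funTS.
  - by move=> x _; rewrite lee_fin ger0_norm; case/andP: (phi_bnd x).
have := @FTC1 _ phi (BLeft 0) (fun y => bounded_itv_integrable true false 0 y) L.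
apply: ae_impl => t H t0; have [d1 d2] := H t0.
by split; [exact: d1|rewrite -derive1E; exact: d2].
Qed.

End Bounded.
End Primitive.

(** * A differential equation with monotone right-hand side *)

Section DelayedEquation.
Context {R : realType}.
Local Notation mu := (@lebesgue_measure R).
Variables (G D : R -> R) (M : R).
Hypotheses (cG : continuous G) (ndG : {homo G : a b / a <= b}).
Hypotheses (bG : forall a, 0 <= G a <= M) (cD : continuous D).
Implicit Types (Y : R -> R) (h s t L : R).

Definition slow_decreasing Y := forall s t, s <= t -> 0 <= Y s - Y t <= M * (t - s).

Lemma slow_decreasing_lipschitz Y s t : slow_decreasing Y ->
  `|Y s - Y t| <= M * `|s - t|.
Proof.
move=> sY; wlog ts : s t / t <= s.
  by move=> H; have [/H//|/ltW/H] := leP t s; rewrite distrC [`|s - t|]distrC.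
have /andP[h1 h2] := sY _ _ ts.
by rewrite distrC ger0_norm // ger0_norm //; lra.
Qed.

Lemma slow_decreasing_continuous Y : slow_decreasing Y -> continuous Y.
Proof.
move=> sY; apply: (@lipschitz_continuous _ _ M) => s t st.
by have /andP[h1 h2] := sY _ _ st; rewrite distrC ger0_norm.
Qed.

Let rhs h Y s := G (Y (s - h) - D s).

Let rhs_continuous h Y : continuous Y -> continuous (rhs h Y).
Proof.
move=> cY s; apply: continuous_comp; last exact: cG.
apply: cvgB; last exact: cD.
apply: (@continuous_comp _ _ _ (fun s => s - h) Y); last exact: cY.
by apply: cvgB; [exact: cvg_id|exact: cvg_cst].
Qed.

Let step h L Y t := L - primitive (rhs h Y) t.

Let measurable_rhs h Y : continuous Y -> measurable_fun setT (rhs h Y).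
Proof. by move=> cY; apply: continuous_measurable_fun; exact: rhs_continuous. Qed.

Let step_slow h L Y : slow_decreasing Y -> slow_decreasing (step h L Y).
Proof.
move=> /slow_decreasing_continuous cY s t st.
have := @primitive_diff _ (rhs h Y) M (measurable_rhs h cY) (fun=> bG _) s t st.
by rewrite /step; lra.
Qed.

Let approx h L i := iter i (step h L) (fun=> L).

Let approx_slow h L i : slow_decreasing (approx h L i).
Proof.
elim: i => [|i IH]; last exact: step_slow.
have M0 : 0 <= M by have := bG 0; lra.
by move=> s t st; rewrite /approx/= subrr lexx mulr_ge0//; lra.
Qed.

Let approx_next h L i t : 0 < h -> t <= i%:R * h -> approx h L i.+1 t = approx h L i t.
Proof.
move=> h0; elim: i t => [|i IH] t ti.
  by rewrite /approx/= /step primitive_le0 ?subr0//; rewrite mul0r in ti.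
rewrite [LHS]/(step h L (approx h L i.+1) t) [RHS]/(step h L (approx h L i) t).
congr (_ - _).
apply: eq_primitive => s st; rewrite /rhs; congr (G (_ - _)).
by apply: IH; rewrite -natr1 mulrDl mul1r in ti; lra.
Qed.

Let approx_stable h L i j t : 0 < h -> t <= i%:R * h -> (i <= j)%N ->
  approx h L j t = approx h L i t.
Proof.
move=> h0 ti; elim: j => [|j IH]; first by rewrite leqn0 => /eqP ->.
rewrite leq_eqVlt => /orP[/eqP -> //|]; rewrite ltnS => ij.
rewrite approx_next ?IH//; apply: le_trans ti _.
by rewrite ler_pM2r// ler_nat.
Qed.

(** The delay makes the equation explicit: up to time (i + 1) h its right-hand
   side only involves the values of Y up to time i h, so Picard's iterates become
   stationary at each time after finitely many steps. *)
Lemma delayed_equation h L : 0 < h -> exists Y, [/\ slow_decreasing Y, (forall t, t <= 0 -> Y t = L) &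
  forall t, 0 < t -> is_derive t 1 Y (- G (Y (t - h) - D t))].
Proof.
move=> h0.
have Nex t : exists n, t <= n%:R * h.
  exists (Num.bound `|t / h|); rewrite -ler_pdivrMr //.
  by apply: le_trans (ler_norm _) _; apply: ltW; apply: archi_boundP.
pose N t := projT1 (cid (Nex t)).
have NP t : t <= (N t)%:R * h by rewrite /N; case: cid.
pose Y t := approx h L (N t) t.
have YE i t : t <= i%:R * h -> Y t = approx h L i t.
  move=> ti; have [iN|/ltnW Ni] := leqP i (N t).
    exact: approx_stable.
  by rewrite (approx_stable _ h0 (NP t)).
have sY : slow_decreasing Y.
  move=> s t st; rewrite (YE (N t) s) ?(le_trans st)// (YE (N t) t)//.
  exact: approx_slow.
have YstepE : Y = step h L Y.
  apply/funext => t; rewrite {1}/Y -approx_next // [LHS]/(step h L (approx h L (N t)) t).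
  congr (_ - _); apply: eq_primitive => s st; rewrite /rhs; congr (G (_ - _)).
  by rewrite (YE (N t))//; have := NP t; lra.
exists Y; split => //.
  by move=> t t0; rewrite YstepE /step primitive_le0 ?subr0.
move=> t t0; rewrite {1}YstepE -[X in is_derive _ _ _ X]sub0r.
have cY := slow_decreasing_continuous sY.
apply: is_deriveB; apply: (@primitive_derive_continuous _ (rhs h Y) M) => //.
- exact: measurable_rhs.
- by move=> s; exact: bG.
- exact: rhs_continuous.
Qed.

(** Once Y exceeds Y' by M h', the value Y (t - h), which is at least Y t, also
   exceeds Y' (t - h'), which is at most Y' t + M h'. As G is nondecreasing,
   Y - Y' then stops growing. *)
Lemma delayed_equation_compare h h' L Y Y' t : 0 < h -> 0 < h' ->
  slow_decreasing Y -> slow_decreasing Y' ->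
  (forall t, t <= 0 -> Y t = L) -> (forall t, t <= 0 -> Y' t = L) ->
  (forall t, 0 < t -> is_derive t 1 Y (- G (Y (t - h) - D t))) ->
  (forall t, 0 < t -> is_derive t 1 Y' (- G (Y' (t - h') - D t))) ->
  Y t - Y' t <= M * h'.
Proof.
move=> h0 h'0 sY sY' Y0 Y'0 dY dY'.
have M0 : 0 <= M by have := bG 0; lra.
have [t0|/ltW t0] := leP t 0.
  by rewrite Y0 // Y'0 // subrr mulr_ge0// ltW.
apply: (@barrier _ (fun s => Y s - Y' s) 0 t) => //.
- apply: (@lipschitz_abs_continuous _ _ (M + M)) => s u _ su _.
  by have := sY _ _ su; have := sY' _ _ su; rewrite ler_norml; lra.
- by rewrite Y0 // Y'0 // subrr mulr_ge0// ltW.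
- apply: aeW => s s0 st Hs.
  have [d1 d2] := is_deriveB (dY s s0) (dY' s s0).
  split; first exact: d1.
  rewrite derive1E [X in X <= _]d2.
  suff : G (Y' (s - h') - D s) <= G (Y (s - h) - D s) by lra.
  apply: ndG.
  have /sY/andP[h1 _] : s - h <= s by lra.
  have /sY'/andP[_] : s - h' <= s by lra.
  by rewrite (_ : s - (s - h') = h'); lra.
Qed.

(** Monotonicity takes the place of a Lipschitz estimate: by
   [delayed_equation_compare], the solutions with delays h and h' differ by at most
   M max(h, h'), so they converge uniformly as the delay vanishes. The limit is the
   supremum of the y_n - M h_n, and its derivative is found by passing to the limit
   in the mean value theorem. *)
Lemma monotone_ode L : exists Y, [/\ slow_decreasing Y, Y 0 = L &
  forall t, 0 < t -> is_derive t 1 Y (- G (Y t - D t))].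
Proof.
have M0 : 0 <= M by have := bG 0; lra.
pose h n : R := n.+1%:R^-1.
have h_gt0 n : 0 < h n by rewrite invr_gt0.
have h_small e : 0 < e -> exists n, M * h n < e /\ h n < e.
  move=> e0; exists (Num.bound ((M + 1) / e)).
  have /archi_boundP : 0 <= (M + 1) / e by rewrite divr_ge0 ?ltW//; lra.
  set N := Num.bound _; rewrite ltr_pdivrMr // => HN.
  have h1 : (M + 1) * h N < e.
    rewrite /h ltr_pdivrMr // mulrC; apply: lt_le_trans HN _.
    by rewrite ler_pM2r // ler_nat.
  have := h_gt0 N; move: (h N) h1 => hN h1 h2.
  have := mulr_ge0 M0 (ltW h2); lra.
pose y_ n := projT1 (cid (delayed_equation L (h_gt0 n))).
have y_slow n : slow_decreasing (y_ n) by rewrite /y_; case: cid => ? [].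
have y_0 n t : t <= 0 -> y_ n t = L by rewrite /y_; case: cid => ? [? + ?]; exact.
have y_der n t : 0 < t -> is_derive t 1 (y_ n) (- G (y_ n (t - h n) - D t)).
  by rewrite /y_; case: cid => ? [? ?]; exact.
have y_cmp n m t : y_ n t - M * h n <= y_ m t + M * h m.
  have := @delayed_equation_compare (h n) (h m) L (y_ n) (y_ m) t (h_gt0 n)
    (h_gt0 m) (y_slow n) (y_slow m) (y_0 n) (y_0 m) (y_der n) (y_der m).
  by have := mulr_ge0 M0 (ltW (h_gt0 n)); lra.
pose S t := range (fun n => y_ n t - M * h n).
pose Y t := sup (S t).
have hS t : has_sup (S t).
  split; first by exists (y_ 0%N t - M * h 0%N), 0%N.
  by exists (y_ 0%N t + M * h 0%N) => _ [n _ <-].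
have Y_near n t : `|Y t - y_ n t| <= M * h n.
  have h1 : y_ n t - M * h n <= Y t by apply: ub_le_sup; [case: (hS t)|exists n].
  have h2 : Y t <= y_ n t + M * h n.
    by apply: ge_sup; [case: (hS t)|move=> _ [m _ <-]].
  by rewrite ler_norml; lra.
have Y_slow : slow_decreasing Y.
  move=> s t st; apply/andP; split; apply/ler_addgt0Pr => e e0.
    have [n [h1 _]] := h_small (e / 2) ltac:(lra).
    have := Y_near n s; have := Y_near n t; rewrite !ler_norml.
    by have := y_slow n s t st; lra.
  have [n [h1 _]] := h_small (e / 2) ltac:(lra).
  have := Y_near n s; have := Y_near n t; rewrite !ler_norml.
  by have := y_slow n s t st; lra.
exists Y; split => //.
  apply/eqP; rewrite -subr_eq0 -normr_le0; apply/ler_addgt0Pr => e e0.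
  have [n [h1 _]] := h_small _ e0.
  by have := Y_near n 0; rewrite y_0//; lra.
move=> t t0; apply: linear_approx_is_derive => e e0.
have /cvgrPdist_le /(_ e e0) /nbhs_ballP[d /= d0 hd] := @cG (Y t - D t).
have d4 : 0 < d / 4 by lra.
have /cvgrPdist_lt /(_ _ d4) /nbhs_ballP[r1 /= r10 hD] := @cD t.
have M1 : 0 < M + 1 by lra.
(* Within r of t, Y and D each vary by at most d / 4; the delay and the distance
   from y_n to Y cost at most d / 4 each once n is large. *)
pose r := Num.min (t / 2) (Num.min r1 (d / 4 / (M + 1))).
have r0 : 0 < r by rewrite /r !lt_min r10 /=; apply/andP; split; [lra|rewrite divr_gt0].
have [rt rr1 rd] : [/\ r < t, r <= r1 & r <= d / 4 / (M + 1)].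
  by split; rewrite /r ?gt_min ?ge_min ?lexx ?orbT//; apply/orP; left; lra.
exists r => // z zt.
apply/ler_addgt0Pr => e' e'0.
have e4 : 0 < Num.min (d / 4) (e' / 2) by rewrite lt_min d4; lra.
have [n [+ hn]] := h_small _ e4; rewrite lt_min => /andP[hnd hne].
have der_near s : `|s - t| < r -> `|G (Y t - D t) - G (y_ n (s - h n) - D s)| <= e.
  move=> st; apply: hd; rewrite /ball/=.
  have h1 : `|D t - D s| < d / 4.
    by apply: hD; rewrite /ball/= distrC; apply: lt_le_trans rr1.
  have h2 : `|Y s - Y t| <= d / 4.
    have := slow_decreasing_lipschitz s t Y_slow.
    move=> h2; apply: le_trans h2 _.
    rewrite ler_pdivlMr // in rd.
    have : M * `|s - t| <= r * (M + 1) by rewrite mulrC ler_pM //; lra.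
    by lra.
  have := y_slow n (s - h n) s; rewrite gerBl (ltW (h_gt0 n)) => /(_ isT) h3.
  rewrite (_ : s - (s - h n) = h n) in h3; last lra.
  have h4 := Y_near n s.
  move: h1 h2 h3 h4 hnd; move: (M * h n) => Mh.
  rewrite !ltr_norml !ler_norml; lra.
have lin : `|y_ n z - y_ n t - (- G (Y t - D t)) * (z - t)| <= e * `|z - t|.
  have mvt a b : a < b -> `|a - t| < r -> `|b - t| < r ->
      exists2 c, `|c - t| < r & y_ n b - y_ n a = (- G (y_ n (c - h n) - D c)) * (b - a).
    move=> ab ra rb; have [x||c cab E] := @MVT _ (y_ n)
      (fun s => - G (y_ n (s - h n) - D s)) a b ab.
    - by move: ra rb; rewrite in_itv/= => ra rb /andP[xa xb]; apply: y_der;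
        move: ra; rewrite ltr_norml; lra.
    - by apply: continuous_subspaceT; apply: slow_decreasing_continuous.
    exists c => //; move: cab; rewrite in_itv/= => /andP[ac cb].
    by move: ra rb; rewrite !ltr_norml; lra.
  have tt : `|t - t| < r by rewrite subrr normr0.
  have [zt'|zt'|->] := ltgtP z t; last by rewrite !subrr mulr0 subr0 normr0 mulr0.
    have [c cr E] := mvt _ _ zt' zt tt.
    have -> : y_ n z - y_ n t - - G (Y t - D t) * (z - t) =
        (G (Y t - D t) - G (y_ n (c - h n) - D c)) * (z - t).
      by rewrite -(opprB (y_ n t)) E; ring.
    by rewrite normrM ler_wpM2r // der_near.
  have [c cr E] := mvt _ _ zt' tt zt.
  have -> : y_ n z - y_ n t - - G (Y t - D t) * (z - t) =
        (G (Y t - D t) - G (y_ n (c - h n) - D c)) * (z - t).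
      by rewrite E; ring.
  by rewrite normrM ler_wpM2r // der_near.
have h1 := Y_near n z; have h2 := Y_near n t.
move: h1 h2 lin; move: (e * `|z - t|) (G (Y t - D t) * (z - t)) (mulNr (G (Y t - D t)) (z - t)) => A B ->.
by rewrite !ler_norml; lra.
Qed.

End DelayedEquation.

(** * Integrals over the positive half-line *)

Section PositiveHalfLine.
Context {R : realType}.
Local Notation mu := (@lebesgue_measure R).
Implicit Types (f : R -> R) (a b s t : R).

Definition continuous_pos f := forall t, 0 < t -> {for t, continuous f}.

Lemma continuous_pos_within f (A : set R) : (forall t, A t -> 0 < t) ->
  continuous_pos f -> {within A, continuous f}.
Proof.
move=> A0 cf; apply: continuous_in_subspaceT => t; rewrite inE => /A0 t0.
exact: cf.
Qed.

Lemma continuous_pos_measurable f (A : set R) : measurable A ->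
  (forall t, A t -> 0 < t) -> continuous_pos f -> measurable_fun A f.
Proof.
move=> mA A0 cf; apply: subspace_continuous_measurable_fun => //.
exact: continuous_pos_within.
Qed.

Lemma powR_continuous_pos c : continuous_pos (fun t => t `^ c).
Proof.
move=> t t0; apply: differentiable_continuous; apply/derivable1_diffP.
by apply: derivable_powR; rewrite in_itv/= t0.
Qed.

Lemma halfline_bigcup (c : R) : 0 < c ->
  \bigcup_n `[c / n.+1%:R, +oo[%classic = `]0, +oo[%classic.
Proof.
move=> c0; apply/seteqP; split => x /=.
  move=> [n _] /=; rewrite !in_itv/= !andbT; apply: lt_le_trans.
  by rewrite divr_gt0.
rewrite in_itv/= andbT => x0; exists (Num.bound (c / x)) => //=.
rewrite in_itv/= andbT ler_pdivrMr // mulrC -ler_pdivrMr //.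
have /archi_boundP : 0 <= c / x by rewrite divr_ge0// ltW.
by move=> /ltW H; apply: le_trans H _; rewrite ler_nat.
Qed.

Lemma cvg_integral_halfline f (c : R) : 0 < c -> continuous_pos f ->
  (forall t, 0 < t -> 0 <= f t) ->
  (\int[mu]_(t in `[(c / n.+1%:R)%R, +oo[) (f t)%:E)%E @[n --> \oo] -->
  (\int[mu]_(t in `]0%R, +oo[) (f t)%:E)%E.
Proof.
move=> c0 cf f0; rewrite -(halfline_bigcup c0).
have pos i t : `[c / i.+1%:R, +oo[%classic t -> 0 < t.
  by rewrite /= in_itv/= andbT; apply: lt_le_trans; rewrite divr_gt0.
pose F n : set R := `[c / n.+1%:R, +oo[%classic.
have H := @ge0_nondecreasing_set_cvg_integral _ (measurableTypeR R) R F (fun t => (f t)%:E)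
  (@lebesgue_measure R : {measure set (measurableTypeR R) -> \bar R}).
apply: H; rewrite /F.
- apply/nondecreasing_seqP => n; apply/subsetPset => x /=.
  rewrite !in_itv/= !andbT; apply: le_trans.
  by rewrite ler_pM2l // lef_pV2 ?posrE // ler_nat.
- by move=> i; exact: measurable_itv.
- move=> i; apply/measurable_EFinP; apply: continuous_pos_measurable => //.
  exact: (pos i).
- by move=> i x /pos x0; rewrite lee_fin f0.
Qed.

(** Linear substitution up to the singular endpoint 0, where f need not be
   continuous: it is the limit of the substitution on closed half-lines. *)
Lemma integral_halfline_scale f (c : R) : 0 < c -> continuous_pos f ->
  (forall t, 0 < t -> 0 <= f t) ->
  (\int[mu]_(t in `]0%R, +oo[) (f t)%:E =
   \int[mu]_(t in `]0%R, +oo[) (c * f (c * t)%R)%:E)%E.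
Proof.
move=> c0 cf f0.
have cf' : continuous_pos (fun t => c * f (c * t)).
  move=> t t0; apply: cvgM; first exact: cvg_cst.
  apply: (@continuous_comp _ _ _ (fun t => c * t) f).
    by apply: cvgM; [exact: cvg_cst|exact: cvg_id].
  by apply: cf; rewrite mulr_gt0.
have H1 := cvg_integral_halfline c0 cf f0.
have f0' t : 0 < t -> 0 <= c * f (c * t).
  by move=> t0; rewrite mulr_ge0 ?(ltW c0)// f0// mulr_gt0.
have H2 := cvg_integral_halfline ltr01 cf' f0'.
apply: (cvg_unique _ H1) => //.
suff -> : (fun n => \int[mu]_(t in `[(c / n.+1%:R)%R, +oo[) (f t)%:E)%E =
    (fun n => \int[mu]_(t in `[(1 / n.+1%:R)%R, +oo[) (c * f (c * t)%R)%:E)%E by [].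
apply/funext => n.
have dF : (fun t => c * t)^`()%classic = (fun=> c).
  apply/funext => t; rewrite derive1E.
  have -> : (fun t => c * t) = c \*: (@id R) by apply/funext.
  by rewrite deriveZ// derive_id [_ *: _]mulr1.
have n0 : 0 < 1 / n.+1%:R :> R by rewrite divr_gt0.
have -> : c / n.+1%:R = c * (1 / n.+1%:R) by rewrite mulrA mulr1.
rewrite (@increasing_ge0_integration_by_substitutiony _ (fun t => c * t) f).
- by apply: eq_integral => t _; rewrite dF /= mulrC.
- by move=> x y _ _ xy; rewrite ltr_pM2l.
- by rewrite dF => x _; exact: cst_continuous.
- by rewrite dF; exact: is_cvg_cst.
- by rewrite dF; exact: is_cvg_cst.
- split; first by move=> x _; apply: derivableM.
  apply: cvg_at_right_filter; apply: cvgM; first exact: cvg_cst.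
  exact: cvg_id.
- by apply: gt0_cvgMry => //; exact: cvg_id.
- apply: continuous_pos_within => // t /=; rewrite in_itv/= andbT.
  by apply: lt_le_trans; rewrite mulr_gt0.
- move=> t; rewrite in_itv/= andbT => ht; apply: f0; apply: lt_trans ht.
  by rewrite mulr_gt0.
Qed.

(** The segments [1 / (n + 1), n + 1] exhaust the half-line. *)
Lemma integral_halfline_le f (K : R) : continuous_pos f ->
  (forall t, 0 < t -> 0 <= f t) ->
  (forall a b, 0 < a -> a < b -> (\int[mu]_(t in `[a, b]) (f t)%:E <= K%:E)%E) ->
  (\int[mu]_(t in `]0%R, +oo[) (f t)%:E <= K%:E)%E.
Proof.
move=> cf f0 H.
pose F n : set R := `[1 / n.+1%:R, n.+1%:R]%classic.
have posF n t : F n t -> 0 < t.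
  by rewrite /F/= in_itv/= => /andP[+ _]; apply: lt_le_trans; rewrite divr_gt0.
have FU : \bigcup_n F n = `]0, +oo[%classic.
  apply/seteqP; split => x; first by move=> [n _ /posF]; rewrite /= in_itv/= andbT.
  rewrite /= in_itv/= andbT => x0.
  have x1 : 0 < 1 / x by rewrite divr_gt0.
  have [N HN] : exists N : nat, 1 / x + x < N%:R.
    by exists (Num.bound (1 / x + x)); apply: archi_boundP; lra.
  exists N => //; rewrite /F/= in_itv/= ler_pdivrMr // mulrC -ler_pdivrMr // -natr1.
  by apply/andP; split; lra.
have cvgF : (\int[mu]_(t in F n) (f t)%:E)%E @[n --> \oo] -->
    (\int[mu]_(t in \bigcup_n F n) (f t)%:E)%E.
  have H' := @ge0_nondecreasing_set_cvg_integral _ (measurableTypeR R) R F (fun t => (f t)%:E)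
    (@lebesgue_measure R : {measure set (measurableTypeR R) -> \bar R}).
  apply: H'.
  - apply/nondecreasing_seqP => n; apply/subsetPset => x; rewrite /F/= !in_itv/=.
    move=> /andP[h1 h2]; apply/andP; split.
      by apply: le_trans h1; rewrite ler_pM2l // lef_pV2 ?posrE // ler_nat.
    by apply: le_trans h2 _; rewrite ler_nat.
  - by move=> i; exact: measurable_itv.
  - move=> i; apply/measurable_EFinP; apply: continuous_pos_measurable => //.
      exact: measurable_itv.
    exact: (posF i).
  - by move=> i x /posF x0; rewrite lee_fin f0.
rewrite -FU -(cvg_lim _ cvgF) //; apply: lime_le; first by apply/cvg_ex; eexists; exact: cvgF.
apply: nearW => n; have [->|n0] := eqVneq n 0%N.
  rewrite /F divr1 set_itv1 integral_set1 lee_fin.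
  have := H 1 2 ltr01 ltac:(lra); rewrite -lee_fin; apply: le_trans.
  by apply: integral_ge0 => t /=; rewrite in_itv/= => /andP[? _]; rewrite lee_fin f0//; lra.
apply: H; first by rewrite divr_gt0.
rewrite div1r; apply: (@lt_trans _ _ 1); first by rewrite invf_lt1 // ltr1n ltnS lt0n.
by rewrite ltr1n ltnS lt0n.
Qed.


(** On a segment f is bounded below by its minimum, which is positive. *)
Lemma integral_segment_gt0 f a b : 0 < a -> a < b -> continuous_pos f ->
  (forall t, 0 < t -> 0 < f t) -> (0 < \int[mu]_(t in `[a, b]) (f t)%:E)%E.
Proof.
move=> a0 ab cf f0.
have posab t : `[a, b]%classic t -> 0 < t.
  by rewrite /= in_itv/= => /andP[+ _]; exact: lt_le_trans.
have [c cab fc] := EVT_min (ltW ab) (continuous_pos_within posab cf).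
have fc0 : 0 < f c by apply: f0; apply: posab.
apply: (@lt_le_trans _ _ (\int[mu]_(t in `[a, b]) (f c)%:E)%E).
  rewrite integral_cst//= itv_measureE ?ltW//.
  by rewrite -EFinM lte_fin mulr_gt0// subr_gt0.
apply: ge0_le_integral => //.
  by move=> t _; rewrite lee_fin ltW.
by apply/measurable_EFinP; apply: continuous_pos_measurable.
Qed.

End PositiveHalfLine.

(** * Euler's Gamma and Beta integrals *)

Section GammaBeta.
Context {R : realType}.
Local Notation mu := (@lebesgue_measure R).
Implicit Types (a b s t r z : R).

Definition gamma_integrand z t := expR (- t) * t `^ (z - 1).

Lemma gamma_integrand_gt0 z t : 0 < t -> 0 < gamma_integrand z t.
Proof. by move=> t0; rewrite mulr_gt0 ?expR_gt0 ?powR_gt0. Qed.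

Lemma gamma_integrand_continuous z : continuous_pos (gamma_integrand z).
Proof.
move=> t t0; apply: cvgM; last exact: powR_continuous_pos.
apply: (@continuous_comp _ _ _ (fun t : R => - t) expR); last exact: continuous_expR.
exact: continuousN.
Qed.

(** The integrand is dominated by a multiple of the derivative of the bounded
   function - 1 / (1 + t ^ z), which treats the singularity at 0 and the tail
   at infinity at the same time. *)
Lemma gamma_integral_lty z : 0 < z ->
  (\int[mu]_(t in `]0%R, +oo[) (gamma_integrand z t)%:E < +oo)%E.
Proof.
move=> z0.
pose n := Num.bound z.
have zn : z <= n.+1%:R.
  by apply: ltW; apply: lt_trans (archi_boundP (ltW z0)) _; rewrite ltr_nat.
(* A comes from t ^ z <= 1 + t ^ (n + 1) and from the term of degree n + 1 in the
   exponential series of t / 2. *)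
pose A : R := 2 + 2 ^+ n.+1 * (n.+1)`!%:R.
have A0 : 0 < A by rewrite addr_gt0 // mulr_gt0 ?exprn_gt0 // ltr0n fact_gt0.
have bound t : 0 < t -> (1 + t `^ z) ^+ 2 <= A ^+ 2 * expR t.
  move=> t0.
  have h1 : t `^ z <= 1 + t ^+ n.+1.
    have tn0 : 0 <= t ^+ n.+1 by rewrite exprn_ge0 // ltW.
    have [t1|/ltW t1] := leP t 1.
      apply: (@le_trans _ _ 1); last by rewrite lerDl.
      have := @ger_powR R t ltac:(by rewrite t0 t1) 0 z (ltW z0).
      by rewrite powRr0.
    apply: (@le_trans _ _ (t ^+ n.+1)); last by rewrite lerDr.
    by rewrite -powR_mulrn ?(ltW t0) // ler_powR.
  have h2 : 1 + t `^ z <= A * expR (t / 2).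
    have := @expR_ge1Dxn _ (t / 2) n ltac:(lra).
    rewrite expr_div_n -mulrA -invfM -lerBrDl.
    set c : R := 2 ^+ n.+1 * _; have c0 : 0 < c by rewrite mulr_gt0 ?exprn_gt0 // ltr0n fact_gt0.
    rewrite ler_pdivrMr // => h3.
    have h4 : 1 <= expR (t / 2) by rewrite leNgt expR_lt1 -leNgt; lra.
    by rewrite /A -/c mulrDl mulrC; lra.
  rewrite -[leRHS]/(A ^+ 2 * expR t) (_ : t = t / 2 + t / 2) ?expRD; last lra.
  rewrite -(_ : t = t / 2 + t / 2); last lra.
  rewrite expr2 (_ : A ^+ 2 * _ = (A * expR (t / 2)) * (A * expR (t / 2))); last ring.
  by rewrite ler_pM // addr_ge0 // powR_ge0.
have p1 t : 0 < 1 + t `^ z by rewrite ltr_pwDl // powR_ge0.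
pose K := A ^+ 2 / z.
have K0 : 0 < K by rewrite divr_gt0 // exprn_gt0.
pose W t := - K * (1 + t `^ z)^-1.
pose W' t := K * (z * t `^ (z - 1)) * (1 + t `^ z) ^- 2.
have dW t : 0 < t -> is_derive t 1 W (W' t).
  move=> t0.
  have d1 := is_derive1_powR z t0.
  have d2 : is_derive t 1 (fun t => 1 + t `^ z) (z * t `^ (z - 1)).
    by rewrite -[X in is_derive _ _ _ X]add0r; apply: is_deriveD.
  have d3 := @is_deriveV _ (fun t => 1 + t `^ z) t _ _ (lt0r_neq0 (p1 t)) d2.
  have d4 := is_deriveZ (- K) d3; apply: (is_derive_eq d4).
  by rewrite /W' /GRing.scale/=; ring.
have cW' : continuous_pos W'.
  move=> t t0; apply: cvgM.
    apply: cvgM; first exact: cvg_cst.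
    by apply: cvgM; [exact: cvg_cst|exact: powR_continuous_pos].
  apply: cvgV; first by rewrite expf_neq0 // lt0r_neq0.
  apply: (@continuous_comp _ _ _ (fun t => 1 + t `^ z) (fun x => x ^+ 2)).
    by apply: cvgD; [exact: cvg_cst|exact: powR_continuous_pos].
  exact: exprn_continuous.
have le_W' t : 0 < t -> gamma_integrand z t <= W' t.
  move=> t0; rewrite /gamma_integrand /W' /K ler_pdivlMr ?exprn_gt0 //.
  rewrite (_ : A ^+ 2 / z * _ = A ^+ 2 * t `^ (z - 1)); last first.
    by field; exact: lt0r_neq0.
  rewrite mulrAC ler_pM2r ?powR_gt0 // expRN mulrC ler_pdivrMr ?expR_gt0 //.
  exact: bound.
apply: (@le_lt_trans _ _ K%:E); last exact: ltry.
apply: integral_halfline_le.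
- exact: gamma_integrand_continuous.
- by move=> t t0; rewrite ltW // gamma_integrand_gt0.
move=> a b a0 ab.
have posab t : `[a, b]%classic t -> 0 < t.
  by rewrite /= in_itv/= => /andP[+ _]; exact: lt_le_trans.
apply: (@le_trans _ _ (\int[mu]_(t in `[a, b]) (W' t)%:E)%E).
  apply: ge0_le_integral => //.
  - by move=> t /posab t0; rewrite lee_fin ltW // gamma_integrand_gt0.
  - apply/measurable_EFinP; apply: continuous_pos_measurable => //.
    exact: gamma_integrand_continuous.
  - by apply/measurable_EFinP; apply: continuous_pos_measurable.
  - by move=> t /posab t0; rewrite lee_fin le_W'.
have cW t : 0 < t -> {for t, continuous W}.
  move=> t0; apply: differentiable_continuous; apply/derivable1_diffP.
  by have [] := dW t t0.
have posoo t : t \in `]a, b[ -> 0 < t.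
  by rewrite in_itv/= => /andP[h _]; apply: lt_trans h.
rewrite (@continuous_FTC2 _ W' W) //.
- rewrite -EFinB lee_fin /W.
  have h1 : (1 + a `^ z)^-1 <= 1 by rewrite invf_le1 // lerDl powR_ge0.
  have h2 : 0 <= (1 + b `^ z)^-1 by rewrite invr_ge0 ltW.
  by have := ler_wpM2l (ltW K0) h1; have := mulr_ge0 (ltW K0) h2; lra.
- exact: continuous_pos_within.
- split; first by move=> t /posoo t0; have [] := dW t t0.
    by apply: cvg_at_right_filter; apply: cW.
  by apply: cvg_at_left_filter; apply: cW; lra.
- by move=> t /posoo t0; rewrite derive1E; have [_] := dW t t0.
Qed.

Lemma GammaE z : 0 < z ->
  (Gamma z)%:E = (\int[mu]_(t in `]0%R, +oo[) (gamma_integrand z t)%:E)%E.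
Proof.
move=> z0; rewrite /Gamma /Rintegral fineK // ge0_fin_numE ?gamma_integral_lty //.
apply: integral_ge0 => t /=; rewrite in_itv/= andbT => t0.
by rewrite lee_fin ltW // gamma_integrand_gt0.
Qed.

Lemma Gamma_gt0 z : 0 < z -> 0 < Gamma z.
Proof.
move=> z0; rewrite -lte_fin GammaE //.
have := @integral_segment_gt0 _ (gamma_integrand z) 1 2 ltr01 ltac:(lra)
  (@gamma_integrand_continuous z) (@gamma_integrand_gt0 z).
move/lt_le_trans; apply.
apply: ge0_subset_integral => //.
- apply/measurable_EFinP; apply: continuous_pos_measurable => //.
    by move=> t; rewrite /= in_itv/= andbT.
  exact: gamma_integrand_continuous.
- by move=> t /=; rewrite in_itv/= andbT => t0; rewrite lee_fin ltW // gamma_integrand_gt0.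
- by move=> t /=; rewrite !in_itv/= andbT; lra.
Qed.

End GammaBeta.

Section GammaBetaIdentity.
Context {R : realType}.
Local Notation mu := (@lebesgue_measure R).
Implicit Types (a b s t r z : R).

Lemma tonelli_halfline (H : R * R -> R) : measurable_fun setT H ->
  (forall s r, 0 < s -> 0 < r -> 0 <= H (s, r)) ->
  (\int[mu]_(s in `]0%R, +oo[) \int[mu]_(r in `]0%R, +oo[) (H (s, r))%:E =
   \int[mu]_(r in `]0%R, +oo[) \int[mu]_(s in `]0%R, +oo[) (H (s, r))%:E)%E.
Proof.
move=> mH H0.
pose S : set R := `]0, +oo[%classic.
have SP s : s \in S = (0 < s) by rewrite /S mem_setE in_itv/= andbT.
pose F (p : R * R) := \1_S p.1 * \1_S p.2 * H p.
have mF : measurable_fun setT (fun p => (F p)%:E).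
  apply/measurable_EFinP; apply: measurable_funM => //.
  have m1S : measurable_fun setT (\1_S : R -> R) by apply: measurable_indic; exact: measurable_itv.
  apply: measurable_funM; first exact: (measurableT_comp m1S measurable_fst).
  exact: (measurableT_comp m1S measurable_snd).
have F0 p : (0%R <= (F p)%:E)%E.
  rewrite lee_fin /F !indicE !SP; case: p => s r /=.
  by case: ltP => s0; case: ltP => r0; rewrite ?(mul0r, mulr0, mul1r) // H0.
have := @fubini_tonelli _ _ (measurableTypeR R) (measurableTypeR R) R mu mu _ mF F0.
have FE s r : F (s, r) = if (s \in S) && (r \in S) then H (s, r) else 0.
  by rewrite /F !indicE /=; case: (s \in S); case: (r \in S); rewrite ?(mul0r, mulr0, mul1r).
have -> : (\int[mu]_s \int[mu]_r (F (s, r))%:E =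
    \int[mu]_(s in S) \int[mu]_(r in S) (H (s, r))%:E)%E.
  rewrite [RHS]integral_mkcond; apply: eq_integral => s _; rewrite patchE.
  case: ifPn => sS; last by apply: integral0_eq => r _; rewrite FE (negbTE sS).
  rewrite [RHS]integral_mkcond; apply: eq_integral => r _.
  by rewrite patchE FE sS /=; case: ifPn.
move=> ->.
rewrite [RHS]integral_mkcond; apply: eq_integral => r _; rewrite patchE.
case: ifPn => rS; last by apply: integral0_eq => s _; rewrite FE (negbTE rS) andbF.
rewrite [RHS]integral_mkcond; apply: eq_integral => s _.
by rewrite patchE FE rS andbT; case: ifPn.
Qed.

Definition beta_integrand a b r := r `^ (b - 1) * (1 + r) `^ (- (a + b)).

Lemma beta_integrand_gt0 a b r : 0 < r -> 0 < beta_integrand a b r.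
Proof. by move=> r0; rewrite mulr_gt0 ?powR_gt0 // addr_gt0. Qed.

Lemma beta_integrand_continuous a b : continuous_pos (beta_integrand a b).
Proof.
move=> r r0; apply: cvgM; first exact: powR_continuous_pos.
apply: (@continuous_comp _ _ _ (fun r => 1 + r) (fun x => x `^ (- (a + b)))).
  by apply: cvgD; [exact: cvg_cst|exact: cvg_id].
by apply: powR_continuous_pos; rewrite addr_gt0.
Qed.

(** Euler's identity. Substituting t = s r in the second factor of
   Gamma a * Gamma b gives a double integral in (s, r); exchanging the order and
   substituting t = s (1 + r) makes Gamma (a + b) appear. *)
Lemma Gamma_beta a b : 0 < a -> 0 < b ->
  ((Gamma (a + b))%:E * \int[mu]_(r in `]0%R, +oo[) (beta_integrand a b r)%:E =
   (Gamma a * Gamma b)%:E)%E.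
Proof.
move=> a0 b0.
have ab0 : 0 < a + b by rewrite addr_gt0.
have posS t : `]0, +oo[%classic t -> 0 < t by rewrite /= in_itv/= andbT.
have mS (f : R -> R) : continuous_pos f -> measurable_fun (`]0, +oo[%classic : set R) (fun t => (f t)%:E).
  by move=> cf; apply/measurable_EFinP; exact: continuous_pos_measurable.
pose H (p : R * R) := p.1 `^ (a + b - 1) * expR (- p.1) * (p.2 `^ (b - 1) * expR (- (p.1 * p.2))).
have mpow c : measurable_fun setT (fun x : R => x `^ c) by exact: measurable_powR.
have mH : measurable_fun setT H.
  apply: measurable_funM; apply: measurable_funM.
  - exact: (measurableT_comp (mpow (a + b - 1)) measurable_fst).
  - apply: (measurableT_comp (@measurable_expR R)).
    exact: (measurableT_comp (@oppr_measurable R _) measurable_fst).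
  - exact: (measurableT_comp (mpow (b - 1)) measurable_snd).
  - apply: (measurableT_comp (@measurable_expR R)).
    apply: (measurableT_comp (@oppr_measurable R _)).
    exact: (measurable_funM measurable_fst measurable_snd).
have H0 s r : 0 < s -> 0 < r -> 0 <= H (s, r).
  by move=> s0 r0; rewrite /H/= !mulr_ge0 ?powR_ge0 ?expR_ge0.
have fin z : 0 < z -> (0 <= (Gamma z)%:E)%E by move=> z0; rewrite lee_fin ltW ?Gamma_gt0.
transitivity (\int[mu]_(r in `]0%R, +oo[) \int[mu]_(s in `]0%R, +oo[) (H (s, r))%:E)%E.
  rewrite -ge0_integralZl //; last 3 first.
  - by apply: mS; exact: beta_integrand_continuous.
  - by move=> r /posS r0; rewrite lee_fin ltW ?beta_integrand_gt0.
  - exact: fin.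
  apply: eq_integral => r; rewrite inE => /posS r0.
  have r1 : 0 < 1 + r by rewrite addr_gt0.
  rewrite GammaE // (@integral_halfline_scale _ (gamma_integrand (a + b)) _ r1) //; last 2 first.
  - exact: gamma_integrand_continuous.
  - by move=> t t0; rewrite ltW ?gamma_integrand_gt0.
  rewrite muleC -ge0_integralZl //; last 3 first.
  - apply: mS => s s0; apply: cvgM; first exact: cvg_cst.
    apply: (@continuous_comp _ _ _ (fun s => (1 + r) * s) (gamma_integrand (a + b))).
      by apply: cvgM; [exact: cvg_cst|exact: cvg_id].
    by apply: gamma_integrand_continuous; rewrite mulr_gt0.
  - move=> s /posS s0; rewrite lee_fin mulr_ge0 ?ltW // gamma_integrand_gt0 //.
    by rewrite mulr_gt0.
  - by rewrite lee_fin ltW ?beta_integrand_gt0.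
  apply: eq_integral => s; rewrite inE => /posS s0.
  rewrite -EFinM; congr (_%:E).
  rewrite /beta_integrand /gamma_integrand /H/= powRM ?(ltW r1) ?(ltW s0) // powRN.
  rewrite (_ : - ((1 + r) * s) = - s + - (s * r)); last ring.
  rewrite expRD.
  have {1}-> : (1 + r) `^ (a + b) = (1 + r) * (1 + r) `^ (a + b - 1).
    by rewrite mulr_powRB1 // ltW.
  by field; rewrite !lt0r_neq0 ?powR_gt0.
rewrite -(tonelli_halfline mH H0).
rewrite EFinM GammaE // muleC -ge0_integralZl //; last 3 first.
- by apply: mS; exact: gamma_integrand_continuous.
- by move=> t /posS t0; rewrite lee_fin ltW ?gamma_integrand_gt0.
- exact: fin.
apply: eq_integral => s; rewrite inE => /posS s0.
rewrite GammaE // (@integral_halfline_scale _ (gamma_integrand b) _ s0) //; last 2 first.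
- exact: gamma_integrand_continuous.
- by move=> t t0; rewrite ltW ?gamma_integrand_gt0.
rewrite muleC -ge0_integralZl //; last 3 first.
- apply: mS => t t0; apply: cvgM; first exact: cvg_cst.
  apply: (@continuous_comp _ _ _ (fun t => s * t) (gamma_integrand b)).
    by apply: cvgM; [exact: cvg_cst|exact: cvg_id].
  by apply: gamma_integrand_continuous; rewrite mulr_gt0.
- move=> t /posS t0; rewrite lee_fin mulr_ge0 ?ltW // gamma_integrand_gt0 //.
  by rewrite mulr_gt0.
- by rewrite lee_fin ltW ?gamma_integrand_gt0.
apply: eq_integral => r; rewrite inE => /posS r0.
rewrite -EFinM; congr (_%:E).
rewrite /gamma_integrand /H/= powRM ?(ltW r0) ?(ltW s0) //.
rewrite (_ : a + b - 1 = (a - 1) + (1 + (b - 1))); last ring.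
rewrite powRD; last by rewrite (lt0r_neq0 s0) implybT.
rewrite [s `^ (1 + _)]powRD; last by rewrite (lt0r_neq0 s0) implybT.
by rewrite powRr1 ?(ltW s0) //; ring.
Qed.

End GammaBetaIdentity.

(** * The settling-time function *)

Section TimeFunction.
Context {R : realType}.
Local Notation mu := (@lebesgue_measure R).
Variables a b : R.
Hypotheses (a0 : 0 < a) (b0 : 0 < b).
Implicit Types y : R.

Lemma beta_integral : (\int[mu]_(r in `]0%R, +oo[) (beta_integrand a b r)%:E =
  (Gamma a * Gamma b / Gamma (a + b))%:E)%E.
Proof.
have G0 : 0 < Gamma (a + b) by rewrite Gamma_gt0 // addr_gt0.
have := Gamma_beta a0 b0.
have : (0 <= \int[mu]_(r in `]0%R, +oo[) (beta_integrand a b r)%:E)%E.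
  apply: integral_ge0 => r /=; rewrite in_itv/= andbT => r0.
  by rewrite lee_fin ltW ?beta_integrand_gt0.
case: (\int[mu]_(_ in _) _)%E => [x| |] //= _; last by rewrite gt0_muley.
rewrite -EFinM => -[E]; congr (_%:E).
by rewrite -E; field; exact: lt0r_neq0.
Qed.

Lemma beta_integrable : mu.-integrable `]0%R, +oo[ (EFin \o beta_integrand a b).
Proof.
apply/integrableP; split.
  apply/measurable_EFinP; apply: continuous_pos_measurable => //.
    by move=> t; rewrite /= in_itv/= andbT.
  exact: beta_integrand_continuous.
apply: le_lt_trans (ltry (Gamma a * Gamma b / Gamma (a + b))).
rewrite -beta_integral le_eqVlt; apply/orP; left; apply/eqP.
apply: eq_integral => r; rewrite inE/= in_itv/= andbT => r0.
by rewrite ger0_norm // ltW // beta_integrand_gt0.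
Qed.

Definition incomplete_beta (y : R) : R := \int[mu]_(r in `]0, y]) beta_integrand a b r.

Lemma incomplete_beta_derive y : 0 < y ->
  is_derive y 1 incomplete_beta (beta_integrand a b y).
Proof.
move=> y0.
have yu : y < y + 1 by rewrite ltrDl.
have ib : mu.-integrable [set` Interval (BRight 0) (BRight (y + 1))] (EFin \o beta_integrand a b).
  apply: integrableS beta_integrable => //.
  by move=> t /=; rewrite !in_itv/= andbT => /andP[].
have [||d1 d2] := @continuous_FTC1 _ (beta_integrand a b) (BRight 0) y (y + 1) yu ib.
- by rewrite lte_fin.
- exact: beta_integrand_continuous.
by split; [exact: d1|rewrite -derive1E; exact: d2].
Qed.

(** The upper bound is strict because the segment [y + 1, y + 2] carries a positive
   part of the complete integral. *)
Lemma incomplete_beta_bounds y : 0 < y ->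
  0 <= incomplete_beta y < Gamma a * Gamma b / Gamma (a + b).
Proof.
move=> y0.
have pos t : `]0, y]%classic t -> 0 < t by rewrite /= in_itv/= => /andP[].
apply/andP; split.
  by apply: Rintegral_ge0 => t /pos t0; rewrite ltW // beta_integrand_gt0.
have intE (D : set R) : measurable D -> D `<=` `]0, +oo[%classic ->
    ((\int[mu]_(r in D) beta_integrand a b r)%:E =
     \int[mu]_(r in D) (beta_integrand a b r)%:E)%E.
  move=> mD D0; rewrite /Rintegral fineK //.
  by apply: integrable_fin_num => //; exact: integrableS beta_integrable.
have mf (D : set R) : measurable D -> D `<=` `]0, +oo[%classic ->
    measurable_fun D (fun r => (beta_integrand a b r)%:E).
  move=> mD D0; apply/measurable_EFinP; apply: continuous_pos_measurable => //.
    by move=> t /D0; rewrite /= in_itv/= andbT.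
  exact: beta_integrand_continuous.
have D1 : `]0, y] `<=` `]0, +oo[%classic.
  by move=> t /=; rewrite !in_itv/= andbT => /andP[].
have D2 : `[y + 1, y + 2] `<=` `]0, +oo[%classic.
  by move=> t /=; rewrite !in_itv/= andbT; lra.
have D12 : `]0, y] `|` `[y + 1, y + 2] `<=` `]0, +oo[%classic by rewrite subUset.
have f0 t : `]0, +oo[%classic t -> (0%R <= (beta_integrand a b t)%:E)%E.
  by rewrite /= in_itv/= andbT => t0; rewrite lee_fin ltW // beta_integrand_gt0.
rewrite -lte_fin -beta_integral intE //.
apply: (@lt_le_trans _ _ (\int[mu]_(r in `]0%R, y] `|` `[(y + 1)%R, (y + 2)%R]) (beta_integrand a b r)%:E)%E).
  rewrite ge0_integral_setU //=; last 3 first.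
  - by apply: mf => //; exact: measurableU.
  - by move=> t /D12; exact: f0.
  - by apply/disj_setPS => t [] /=; rewrite !in_itv/=; lra.
  rewrite -[X in (X < _)%E]adde0 lteD2lE -?intE //.
  rewrite intE //; apply: integral_segment_gt0; [lra|lra| |].
    exact: beta_integrand_continuous.
  exact: beta_integrand_gt0.
by apply: ge0_subset_integral => //; [exact: measurableU|exact: mf].
Qed.

End TimeFunction.

Section SettlingTime.
Context {R : realType}.
Variables alpha beta p q k : R.
Hypotheses (halpha : 0 < alpha) (hbeta : 0 < beta).
Implicit Types x : R.
Hypotheses (hp : 0 < p) (hq : 0 < q) (hk : 0 < k) (hkp : k * p < 1) (hkq : 1 < k * q).

(** Phi x is the time needed to reach 0 from x along x' = - (alpha x^p + beta
   x^q)^k; the change of variable r = (beta / alpha) x^(q - p) turns it into an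
   incomplete Beta integral. *)
Lemma settling_time_function :
  let mp := (1 - k * p) / (q - p) in
  let mq := (k * q - 1) / (q - p) in
  let gamma := Gamma mp * Gamma mq / (alpha `^ k * Gamma k * (q - p))
               * (alpha / beta) `^ mp in
  exists Phi : R -> R, forall x : R, 0 < x -> 0 <= Phi x < gamma /\
    is_derive x 1 Phi ((alpha * x `^ p + beta * x `^ q) `^ k)^-1.
Proof.
move=> mp mq gamma.
have pq : 0 < q - p.
  by rewrite subr_gt0 -(ltr_pM2l hk); apply: lt_trans hkp hkq.
have mp0 : 0 < mp by rewrite divr_gt0 // subr_gt0.
have mq0 : 0 < mq by rewrite divr_gt0 // subr_gt0.
have mpq : mq + mp = k by rewrite /mp /mq; field; exact: lt0r_neq0.
have ba0 : 0 < beta / alpha by rewrite divr_gt0.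
have ab0 : 0 < alpha / beta by rewrite divr_gt0.
pose C := (alpha `^ k)^-1 * (alpha / beta) `^ mp / (q - p).
have C0 : 0 < C by rewrite divr_gt0 // mulr_gt0 ?invr_gt0 ?powR_gt0.
pose rho x := beta / alpha * x `^ (q - p).
have rho0 x : 0 < x -> 0 < rho x by move=> x0; rewrite mulr_gt0 ?powR_gt0.
have gammaE : gamma = C * (Gamma mq * Gamma mp / Gamma (mq + mp)).
  by rewrite mpq /gamma /C !invfM; ring.
exists (fun x => C * incomplete_beta mq mp (rho x)) => x x0; split.
  have /andP[h1 h2] := incomplete_beta_bounds mq0 mp0 (rho0 _ x0).
  by rewrite gammaE ltr_pM2l // h2 andbT mulr_ge0 // ltW.
have d1 := is_derive1_powR (q - p) x0.
have d2 : is_derive x 1 rho (beta / alpha * ((q - p) * x `^ (q - p - 1))).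
  exact: (is_deriveZ (beta / alpha) d1).
have d3 := is_derive1_comp (incomplete_beta_derive mq0 mp0 (rho0 _ x0)) d2.
have d4 := is_deriveZ C d3; apply: (is_derive_eq d4).
rewrite /GRing.scale/= /beta_integrand mpq.
have -> : alpha * x `^ p + beta * x `^ q = alpha * x `^ p * (1 + rho x).
  rewrite (_ : q = p + (q - p)) /rho; last ring.
  rewrite powRD; last by rewrite (lt0r_neq0 x0) implybT.
  by field; exact: lt0r_neq0.
have r1 : 0 < 1 + rho x by rewrite addr_gt0 // rho0.
have ax : 0 <= alpha * x `^ p by rewrite mulr_ge0 ?powR_ge0 // ltW.
rewrite (powRM _ ax (ltW r1)) (powRM _ (ltW halpha) (powR_ge0 _ _)) powRN.
have -> : rho x `^ (mp - 1) = rho x `^ mp / rho x.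
  by rewrite powRB ?(lt0r_neq0 (rho0 _ x0)) ?implybT // powRr1 // ltW // rho0.
have -> : x `^ (q - p - 1) = x `^ (q - p) / x.
  by rewrite [LHS]powRB ?(lt0r_neq0 x0) ?implybT // powRr1 // ltW.
have E : rho x `^ mp = (beta / alpha) `^ mp * (x / (x `^ p) `^ k).
  rewrite /rho powRM ?powR_ge0 ?(ltW ba0) //; congr (_ * _).
  rewrite -powRrM (_ : (q - p) * mp = 1 - p * k); last first.
    by rewrite /mp; field; exact: lt0r_neq0.
  by rewrite powRB ?(lt0r_neq0 x0) ?implybT // powRr1 ?powRrM // ltW.
have inv : (alpha / beta) `^ mp * (beta / alpha) `^ mp = 1.
  rewrite -powRM ?(ltW ab0) ?(ltW ba0) // (_ : alpha / beta * _ = 1) ?powR1 //.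
  by field; rewrite !lt0r_neq0.
rewrite E /C.
transitivity (((alpha / beta) `^ mp * (beta / alpha) `^ mp) *
   (alpha `^ k * (x `^ p) `^ k * (1 + rho x) `^ k)^-1); last by rewrite inv mul1r.
rewrite /rho; field.
by rewrite !lt0r_neq0 ?powR_gt0 // addr_gt0 // mulr_gt0 ?powR_gt0.
Qed.

End SettlingTime.

(** * Filippov sets *)

Section FilippovLemmas.
Context {R : realType}.
Local Notation mu := (@lebesgue_measure R).
Implicit Types (f : R -> R -> R) (t y v l c d r : R).

(** The empty set is a null set and a segment is closed and convex. *)
Lemma filippov_bounds f t y v c d r : 0 < r ->
  (forall z, `|z - y| < r -> c <= f t z <= d) -> filippov f t y v -> c <= v <= d.
Proof.
have n0 : mu.-negligible (set0 : set R) by exact: negligible_set0.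
move=> r0 fr /(_ r r0 set0 n0 `[c, d]%classic).
rewrite /= in_itv/=; apply; split; first exact: itv_closed.
  have key (x z : R) (l : {i01 R}) : c <= x <= d -> c <= z <= d ->
      c <= l%:num * x + (1 - l%:num) * z <= d.
    move=> /andP[cx xd] /andP[cz zd].
    have l0 : 0 <= l%:num :> R by [].
    have l1 : 0 <= 1 - l%:num :> R by rewrite subr_ge0.
    have := ler_wpM2l l0 cx; have := ler_wpM2l l0 xd.
    by have := ler_wpM2l l1 cz; have := ler_wpM2l l1 zd; lra.
  move=> x z l; rewrite !inE/= !in_itv/=; exact: key.
move=> _ [z [bz _] <-]; rewrite /= in_itv/=; apply: fr.
by move: bz; rewrite /ball/= distrC.
Qed.

Lemma filippov_continuous f t y v : {for y, continuous (f t)} ->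
  filippov f t y v -> v = f t y.
Proof.
move=> cf fv; apply/eqP; rewrite -subr_eq0 -normr_le0; apply/ler_addgt0Pr => e e0.
have /cvgrPdist_le /(_ e e0) /nbhs_ballP[r /= r0 hr] := cf.
have := @filippov_bounds f t y v (f t y - e) (f t y + e) r r0 _ fv.
rewrite add0r ler_norml; move=> H.
suff /H : forall z, `|z - y| < r -> f t y - e <= f t z <= f t y + e by lra.
move=> z zy; have := hr z; rewrite /ball/= distrC => /(_ zy).
by rewrite ler_norml; lra.
Qed.

(** A value that f t approaches on intervals arbitrarily close to y cannot be
   removed by discarding a null set. *)
Lemma filippov_limit f t y l :
  (forall e r, 0 < e -> 0 < r -> exists a b, [/\ a < b, `]a, b[ `<=` ball y r &
     forall z, a < z < b -> `|f t z - l| < e]) ->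
  filippov f t y l.
Proof.
move=> H r /= r0 N nN C [clC _ fC].
apply: clC => A /nbhs_ballP[e /= e0 eA].
have [a [b [ab abr fab]]] := H e r e0 r0.
have [z [abz nNz]] : exists z, a < z < b /\ ~ N z.
  apply: contrapT => nex.
  have : mu.-negligible `]a, b[%classic.
    apply: negligibleS nN => z /=; rewrite in_itv/= => zab.
    by apply: contrapT => nNz; apply: nex; exists z.
  move/negligibleP => /(_ (measurable_itv _)) E.
  have := etrans (esym (itv_measureE false true (ltW ab))) E.
  by case => E'; lra.
exists (f t z); split.
  by apply: fC; exists z => //; split => //; apply: abr; rewrite /= in_itv/=.
by apply: eA; rewrite /ball/= distrC; exact: fab.
Qed.

Lemma filippov_value f t y : {for y, continuous (f t)} -> filippov f t y (f t y).
Proof.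
move=> cf; apply: filippov_limit => e r e0 r0.
have /cvgrPdist_lt /(_ e e0) /nbhs_ballP[s /= s0 hs] := cf.
exists y, (y + Num.min r s); split.
- by rewrite ltrDl lt_min r0.
- move=> z; rewrite /= in_itv/= => /andP[yz zy].
  have : Num.min r s <= r by rewrite ge_min lexx.
  by rewrite /ball/= ltr_norml; lra.
- move=> z /andP[yz zy]; rewrite distrC; apply: hs.
  have : Num.min r s <= s by rewrite ge_min lexx orbT.
  by rewrite /ball/= ltr_norml; lra.
Qed.

Lemma filippov_convex f t y c d v : filippov f t y c -> filippov f t y d ->
  c <= v <= d -> filippov f t y v.
Proof.
move=> fc fd /andP[cv vd] r r0 N nN C hC.
have Cc := fc r r0 N nN C hC; have Cd := fd r r0 N nN C hC.
have [cd|cd] := eqVneq c d; first by rewrite (_ : v = c) //; lra.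
have [_ cvC _] := hC.
have dc : 0 < d - c by rewrite subr_gt0 lt_neqAle cd; lra.
have l0 : 0 <= (d - v) / (d - c) by rewrite divr_ge0; lra.
have l1 : (d - v) / (d - c) <= 1 by rewrite ler_pdivrMr //; lra.
have E : v = (d - v) / (d - c) * c + (1 - (d - v) / (d - c)) * d by field; lra.
by have := cvC c d (Itv01 l0 l1); rewrite !inE => /(_ Cc Cd); rewrite {2}E.
Qed.

End FilippovLemmas.

(** * Existence of trajectories *)

Section BorelVersion.
Context {R : realType}.
Local Notation mu := (@lebesgue_measure R).

Definition borel_off_null (f : R -> R) := exists N : set R,
  [/\ measurable N, mu N = 0%E & measurable_fun (`[0, +oo[ `\` N) f].

(** Each rational sublevel set is Borel up to a null set; removing the countable
   union of these null sets makes all sublevel sets Borel. *)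
Lemma lebesgue_measurable_borel (f : R -> R) :
  lebesgue_measurable_fun `[0, +oo[ f -> borel_off_null f.
Proof.
move=> mf.
have mS : measurable (`[0, +oo[%classic : set R) by exact: measurable_itv.
have sub (r : rat) : exists AN : set R * set R, [/\ measurable AN.1,
    mu.-negligible AN.2 & `[0, +oo[ `&` f @^-1` `]-oo, ratr r[ = AN.1 `|` AN.2].
  have : (completed_algebra_gen mu).-sigma.-measurable
      (`[0, +oo[ `&` f @^-1` `]-oo, ratr r[).
    have mS' : (completed_algebra_gen mu).-sigma.-measurable (`[0, +oo[%classic : set R).
      rewrite g_sigma_completed_algebra_genE.
      by exists `[0, +oo[%classic => //; exists set0; [exact: negligible_set0|rewrite setU0].
    by apply: (mf mS'); exact: measurable_itv.
  by rewrite g_sigma_completed_algebra_genE => -[A mA [N nN E]]; exists (A, N).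
have [AN HAN] := choice sub.
have : mu.-negligible (\bigcup_n if unpickle n is Some r then (AN r).2 else set0).
  apply: negligible_bigcup => n; case: (unpickle n) => [r|].
    by have [] := HAN r.
  exact: negligible_set0.
move=> [N [mN N0 sN]]; exists N; split => //.
have sN' r : (AN r).2 `<=` N.
  by move=> t rt; apply: sN; exists (pickle r); [exact: I|rewrite pickleK].
apply: (measurability _ (RGenInftyO.measurableE R)).
move=> _ [_ [x ->] <-].
rewrite (_ : _ `&` _ = \bigcup_r if ratr r < x then (`[0, +oo[ `\` N) `&` (AN r).1 else set0).
  apply: bigcupT_measurable_rat => r; case: ifPn => // _.
  apply: measurableI; first exact: measurableD.
  by have [] := HAN r.
apply/seteqP; split => t.
  move=> [[t0 nNt] /=]; rewrite in_itv/= => ftx.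
  have [r] := rat_in_itvoo ftx; rewrite in_itv/= => /andP[fr rx].
  exists r => //; rewrite rx; split; first by [].
  have [_ _ E] := HAN r.
  have : (`[0, +oo[ `&` f @^-1` `]-oo, ratr r[) t by split => //=; rewrite in_itv/=.
  by rewrite E => -[//|/sN'].
move=> [r _]; case: ifPn => // rx [[t0 nNt] At]; split => //=.
have [_ _ E] := HAN r.
have : (AN r).1 `|` (AN r).2 = (AN r).1 `|` (AN r).2 by [].
rewrite -{1}E => E'; have : ((AN r).1 `|` (AN r).2) t by left.
by rewrite -E' => -[_ /=]; rewrite !in_itv/= => h; apply: lt_trans rx.
Qed.

Lemma borel_off_nullN (f : R -> R) : borel_off_null f -> borel_off_null (fun t => - f t).
Proof.
move=> [N [mN N0 mf]]; exists N; split => //.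
exact: (measurableT_comp (@oppr_measurable R _) mf).
Qed.

End BorelVersion.

Section Existence.
Context {R : realType}.
Local Notation mu := (@lebesgue_measure R).
Variables (g : R -> R) (zeta : R).
Hypotheses (cg : continuous g) (g0 : g 0 = 0).
Hypotheses (ndg : forall x y, 0 <= x -> x <= y -> g x <= g y).
Implicit Types (Delta x : R -> R) (s t L : R).

(** The primitive D of zeta - Delta absorbs the merely measurable part of the
   equation: x = Y - D, where Y solves an equation with continuous right-hand
   side. Since Y - D is nonincreasing, truncating it at 0 gives a trajectory
   that reaches 0 and stays there; only the hitting time itself escapes the case
   analysis. *)
Lemma nonneg_trajectory Delta s L : borel_off_null Delta ->
  (forall t, 0 <= t -> `|Delta t| <= zeta) -> 0 <= s -> 0 <= L ->
  exists x K, [/\ x s = L,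
    forall t1 t2, s <= t1 -> t1 <= t2 -> `|x t2 - x t1| <= K * (t2 - t1) &
    {ae mu, forall t, s < t -> 0 <= x t /\
      is_derive t 1 x (if 0 < x t then - (g (x t) + zeta) + Delta t else 0)}].
Proof.
move=> [N [mN N0 mf]] bD s0 L0.
have zeta0 : 0 <= zeta by have := bD 0 (lexx 0); have := normr_ge0 (Delta 0); lra.
(* A Borel function, equal to zeta - Delta almost everywhere on [0, +oo[. *)
pose d := (fun t => zeta - Delta t) \_ (`[0, +oo[ `\` N).
have md : measurable_fun setT d.
  apply/(measurable_restrictT _ _).1; first exact: measurableD.
  exact: measurable_funB.
have bd t : 0 <= d t <= zeta + zeta.
  rewrite /d patchE; case: ifPn => [|_] /=; last by rewrite lexx addr_ge0.
  rewrite inE => -[/=]; rewrite in_itv/= andbT => t0 _.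
  by have := bD t t0; rewrite ler_norml; lra.
pose D := primitive d.
have D_diff a b : a <= b -> 0 <= D b - D a <= (zeta + zeta) * (b - a).
  by move=> ab; exact: primitive_diff.
have cD : continuous D.
  apply: (@lipschitz_continuous _ _ (zeta + zeta)) => r t rt.
  by have /andP[h1 h2] := D_diff _ _ rt; rewrite ger0_norm.
have mono_min : {homo (fun z : R => Num.min (Num.max z 0) L) : a b / a <= b}.
  move=> a b ab; rewrite le_min ge_min !ge_max le_max ab /= le_max lexx orbT /=.
  by rewrite ge_min lexx orbT.
(* The trajectory stays in [0, L], where clamping does not change g; it makes the
   right-hand side bounded and nondecreasing on the whole line. *)
pose G (z : R) := g (Num.min (Num.max z 0) L).
have clampP (z : R) : 0 <= Num.min (Num.max z 0) L <= L.
  by rewrite le_min le_max lexx orbT L0 /= ge_min lexx orbT.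
have cG : continuous G.
  have cclamp : continuous (fun z : R => Num.min (Num.max z 0) L).
    move=> z; apply: (@continuous_min _ _ (fun z : R => Num.max z 0) (fun=> L)); last exact: cvg_cst.
    by apply: (@continuous_max _ _ (id : R -> R) (fun=> 0)); [exact: cvg_id|exact: cvg_cst].
  by move=> z; apply: (continuous_comp (cclamp z)); exact: cg.
have ndG : {homo G : a b / a <= b}.
  by move=> a b ab; apply: ndg; [case/andP: (clampP a)|exact: mono_min].
have bG z : 0 <= G z <= g L.
  have /andP[h1 h2] := clampP z.
  by rewrite /G -{1}g0; apply/andP; split; apply: ndg.
pose Ds r := D (s + r) - D s.
have cDs : continuous Ds.
  move=> r; apply: cvgB; last exact: cvg_cst.
  apply: (@continuous_comp _ _ _ (fun r => s + r) D); last exact: cD.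
  by apply: cvgD; [exact: cvg_cst|exact: cvg_id].
have [Y [Yslow Y0 dY]] := @monotone_ode _ G Ds (g L) cG ndG bG cDs L.
pose z t := Y (t - s) - (D t - D s).
have z_diff a b : a <= b -> 0 <= z a - z b <= (g L + (zeta + zeta)) * (b - a).
  move=> ab; have := D_diff a b ab.
  have := Yslow (a - s) (b - s); rewrite lerB // => /(_ isT).
  rewrite (_ : b - s - (a - s) = b - a); last ring.
  by rewrite /z; lra.
have zs : z s = L by rewrite /z !subrr Y0 subr0.
have zL t : s <= t -> z t <= L by move=> /z_diff; rewrite zs; lra.
pose x t := Num.max (z t) 0.
(* At most one point: the first time where z is nonpositive. *)
pose Bad := [set t | [/\ s < t, z t <= 0 & forall r, s <= r -> r < t -> 0 < z r]].
have nBad : mu.-negligible Bad.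
  have [[t0 Bt0]|nB] := pselect (exists t, Bad t); last first.
    rewrite (_ : Bad = set0); first exact: negligible_set0.
    by apply/seteqP; split => // t Bt; apply: nB; exists t.
  apply: negligibleS (negligible_set1 t0) => t [st zt Ht] /=.
  have [st0 zt0 Ht0] := Bt0.
  have [tt|tt|//] := ltgtP t t0.
    by have := Ht0 t (ltW st) tt; lra.
  by have := Ht t0 (ltW st0) tt; lra.
exists x, (g L + (zeta + zeta)); split.
- by rewrite /x zs; apply/max_idPl.
- move=> t1 t2 _ t12; have := z_diff _ _ t12.
  rewrite /x; case: (leP (z t2) 0) => h2; case: (leP (z t1) 0) => h1.
  + by rewrite subrr normr0; lra.
  + by rewrite ler_norml; lra.
  + by rewrite ler_norml; lra.
  + by rewrite ler_norml; lra.
have aeN : {ae mu, forall t, ~ N t} by apply: negligible_ae; exists N; split.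
have aeD := primitive_derive_ae md bd.
apply: ae_impl (ae_and (ae_and aeN aeD) (negligible_ae nBad)) => t [[nNt dD] nB] st.
have t0 : 0 < t by lra.
split; first by rewrite /x le_max lexx orbT.
have dt : d t = zeta - Delta t.
  by rewrite /d patchE mem_set //; split => //=; rewrite in_itv/= andbT ltW.
have dz : is_derive t 1 z (- G (z t) - d t).
  have ts0 : 0 < t - s by lra.
  have d1 : is_derive t 1 (fun t => t - s) (1 : R).
    by rewrite -[X in is_derive _ _ _ X]subr0; apply: is_deriveB.
  have d2 := @is_derive1_comp _ Y (fun t => t - s) t _ _ (dY _ ts0) d1.
  have d3 : is_derive t 1 (fun t => D t - D s) (d t).
    by rewrite -[X in is_derive _ _ _ X]subr0; apply: is_deriveB; exact: dD.
  apply: (is_derive_eq (is_deriveB d2 d3)).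
  by rewrite mulr1 /z /Ds (_ : s + (t - s) = t); last ring.
have cz : {for t, continuous z}.
  by apply: differentiable_continuous; apply/derivable1_diffP; case: dz.
rewrite /x; have [zt|zt] := leP (z t) 0.
  have [r [sr rt zr]] : exists r, [/\ s <= r, r < t & z r <= 0].
    apply: contrapT => nr; apply: nB; split => // r sr rt; rewrite ltNge.
    by apply/negP => zr; apply: nr; exists r.
  rewrite ltxx; apply: (@near_eq_is_derive _ _ _ (cst 0)).
  near=> u; apply/esym/max_idPr; apply: le_trans zr.
  have /ltW/z_diff : r < u by near: u; exact: lt_nbhsr.
  by lra.
rewrite zt; apply: (@near_eq_is_derive _ _ _ z).
  near=> u; apply/esym/max_idPl; apply: ltW.
  by near: u; apply: (cvgr_gt _ cz).
apply: (is_derive_eq dz); rewrite dt /G.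
have -> : Num.max (z t) 0 = z t by apply/max_idPl/ltW.
have -> : Num.min (z t) L = z t by apply/min_idPl/zL/ltW.
by ring.
Unshelve. all: by end_near. Qed.

End Existence.

(** * Estimates on Filippov solutions *)

Section FilippovField.
Context {R : realType}.
Local Notation mu := (@lebesgue_measure R).
Variables (g : R -> R) (zeta : R).
Hypotheses (cg : continuous g) (g0 : g 0 = 0) (eg : forall x, g (- x) = g x).
Hypotheses (ndg : forall x y, 0 <= x -> x <= y -> g x <= g y).
Implicit Types (Delta x : R -> R) (s t y z : R) (tau : \bar R).

Definition field Delta t y := - (g y + zeta) * Num.sg y + Delta t.

Let g_norm y : g `|y| = g y.
Proof. by have [y0|/ltW y0] := leP 0 y; [rewrite ger0_norm|rewrite ler0_norm]. Qed.

Let g_ge0 y : 0 <= g y.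
Proof. by rewrite -g_norm -g0; exact: ndg. Qed.

Lemma fieldN Delta t y : field (fun t => - Delta t) t (- y) = - field Delta t y.
Proof. by rewrite /field sgrN eg; ring. Qed.

Lemma field_gt0 Delta t y : 0 < y -> field Delta t y = - (g y + zeta) + Delta t.
Proof. by move=> y0; rewrite /field gtr0_sg // mulr1. Qed.

Lemma field_continuous Delta t y : y != 0 -> {for y, continuous (field Delta t)}.
Proof.
move=> y0; rewrite /field; apply: cvgD; last exact: cvg_cst.
apply: cvgM; first by apply: cvgN; apply: cvgD; [exact: cg|exact: cvg_cst].
apply: cvg_near_cst.
have [yn|yp|/eqP] := ltgtP y 0; last by rewrite (negbTE y0).
  near=> z; rewrite !ltr0_sg //; near: z; exact: lt_nbhsl.
by near=> z; rewrite !gtr0_sg //; near: z; exact: lt_nbhsr.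
Unshelve. all: by end_near. Qed.

Lemma field_bound Delta t y z r : `|z - y| < 1 -> `|y| <= r ->
  `|field Delta t z| <= g (r + 1) + `|zeta| + `|Delta t|.
Proof.
move=> zy yr.
have zr : `|z| <= r + 1.
  rewrite -(subrK y z) (le_trans (ler_normD _ _)) //; lra.
apply: le_trans (ler_normD _ _) _; rewrite lerD2r normrM normrN.
have s1 : `|Num.sg z| <= 1 by rewrite normr_sg; case: (z != 0) => //=.
apply: le_trans (_ : `|g z + zeta| <= _).
  by rewrite ler_piMr.
apply: le_trans (ler_normD _ _) _; rewrite lerD2r ger0_norm // -g_norm.
exact: ndg.
Qed.

(** At the discontinuity the Filippov set contains both one-sided limits
   Delta t - zeta and Delta t + zeta, hence 0 when zeta dominates Delta. *)
Lemma filippov_field0 Delta t : `|Delta t| <= zeta -> filippov (field Delta) t 0 0.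
Proof.
move=> Dz.
have small e r : 0 < e -> 0 < r -> exists h, [/\ 0 < h, h <= r &
    forall z, 0 < z -> z < h -> g z < e].
  move=> e0 r0; have /cvgrPdist_lt /(_ e e0) /nbhs_ballP[d /= d0 hd] := @cg 0.
  exists (Num.min r d); split; first by rewrite lt_min r0.
    by rewrite ge_min lexx.
  move=> z z0; rewrite lt_min => /andP[_ zd].
  have := hd z; rewrite /ball/= sub0r normrN gtr0_norm // => /(_ zd).
  by rewrite g0 sub0r normrN ger0_norm.
apply: (@filippov_convex _ _ _ _ (Delta t - zeta) (Delta t + zeta)).
- apply: filippov_limit => e r e0 r0; have [h [h0 hr gh]] := small e r e0 r0.
  exists 0, h; split => //.
    by move=> z; rewrite /= in_itv/= => /andP[z0 zh]; rewrite /ball/= ltr_norml; lra.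
  move=> z /andP[z0 zh]; rewrite field_gt0 //.
  by have := gh z z0 zh; have := g_ge0 z; rewrite ltr_norml; lra.
- apply: filippov_limit => e r e0 r0; have [h [h0 hr gh]] := small e r e0 r0.
  exists (- h), 0; split; first lra.
    by move=> z; rewrite /= in_itv/= => /andP[z0 zh]; rewrite /ball/= ltr_norml; lra.
  move=> z /andP[hz z0]; rewrite /field ltr0_sg //.
  have := gh (- z) _ _; rewrite eg => /(_ _ _) H.
  by have := H ltac:(lra) ltac:(lra); have := g_ge0 z; rewrite ltr_norml; lra.
- by move: Dz; rewrite ler_norml; lra.
Qed.

(** What the estimates use of a Filippov solution on [0, tau[; unlike the
   Filippov inclusion itself, it is obviously stable under x |-> - x. *)
Definition off_zero_solution Delta (tau : \bar R) x :=
  (forall b, 0 <= b -> (b%:E < tau)%E -> abs_continuous 0 b x) /\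
  {ae mu, forall t, 0 < t -> (t%:E < tau)%E -> x t != 0 ->
     is_derive t 1 x (field Delta t (x t))}.

Lemma off_zero_solutionN Delta tau x : off_zero_solution Delta tau x ->
  off_zero_solution (fun t => - Delta t) tau (fun t => - x t).
Proof.
move=> [acx aex]; split.
  by move=> b b0 bt; apply: abs_continuousN; exact: acx.
apply: ae_impl aex => t H t0 tt; rewrite oppr_eq0 => xt.
by rewrite fieldN; apply: is_deriveN; exact: H.
Qed.

Lemma is_solution_off_zero Delta (x0 : R) tau x : is_solution (field Delta) x0 tau x ->
  off_zero_solution Delta tau x.
Proof.
move=> [_ _ acx aex]; split => //; apply: ae_impl aex => t H t0 tt xt.
have [dx fx] := H t0 tt.
rewrite -(filippov_continuous (@field_continuous Delta t _ xt) fx) derive1E.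
exact: derivableP.
Qed.

Section Estimates.
Variables (Delta : R -> R) (tau : \bar R).
Hypothesis bD : forall t, 0 <= t -> `|Delta t| <= zeta.

(** Where x is positive it does not increase, since zeta dominates Delta. *)
Lemma off_zero_solution_le x s t : off_zero_solution Delta tau x ->
  0 <= s -> s <= t -> (t%:E < tau)%E -> x t <= Num.max (x s) 0.
Proof.
move=> [acx aex] s0 st tt; apply: (@barrier _ x s t) => //.
- by apply: abs_continuous_sub (acx t _ tt) => //; lra.
- by rewrite le_max lexx.
apply: ae_impl aex => r H sr rt; rewrite gt_max => /andP[_ xr].
have r0 : 0 < r by lra.
have [||d1 d2] := H r0.
- by apply: lt_trans tt; rewrite lte_fin.
- exact: lt0r_neq0.
split => //; rewrite derive1E d2 field_gt0 //.
have := bD (ltW r0); rewrite ler_norml.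
by have := g_ge0 (x r); lra.
Qed.

End Estimates.

Lemma off_zero_solution_norm Delta tau x s t :
  (forall t, 0 <= t -> `|Delta t| <= zeta) -> off_zero_solution Delta tau x ->
  0 <= s -> s <= t -> (t%:E < tau)%E -> `|x t| <= `|x s|.
Proof.
move=> bD sx s0 st tt.
have bDN r : 0 <= r -> `|- Delta r| <= zeta by rewrite normrN; exact: bD.
have h1 := off_zero_solution_le bD sx s0 st tt.
have h2 := off_zero_solution_le bDN (off_zero_solutionN sx) s0 st tt.
have h3 := ler_norm (x s); have h4 := ler_norm (- x s); have h5 := normr_ge0 (x s).
rewrite normrN in h4.
have : Num.max (x s) 0 <= `|x s| by rewrite ge_max h3.
have : Num.max (- x s) 0 <= `|x s| by rewrite ge_max h4.
by rewrite ler_norml; lra.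
Qed.

(** Since |x| never exceeds |x0|, the field is uniformly bounded on the unit
   neighbourhoods of the states visited, hence so are all Filippov velocities,
   including those at the discontinuity. *)
Lemma solution_lipschitz Delta (x0 : R) tau x s t :
  (forall t, 0 <= t -> `|Delta t| <= zeta) -> is_solution (field Delta) x0 tau x ->
  0 <= s -> s <= t -> (t%:E < tau)%E ->
  `|x t - x s| <= (g (`|x0| + 1) + zeta + zeta) * (t - s).
Proof.
move=> bD sx s0 st tt; set K := _ + _ + _.
have [_ x00 acx aex] := sx.
have zeta0 : 0 <= zeta by have := bD 0 (lexx 0); have := normr_ge0 (Delta 0); lra.
have acst : abs_continuous s t x.
  by apply: abs_continuous_sub (acx t _ tt) => //; lra.
have dK : {ae mu, forall r, s < r -> r < t -> derivable x r 1 /\ - K <= x^`()%classic r <= K}.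
  apply: ae_impl aex => r H sr rt; have r0 : 0 < r by lra.
  have rtau : (r%:E < tau)%E by apply: lt_trans tt; rewrite lte_fin.
  have [dx fx] := H r0 rtau; split => //.
  apply: (filippov_bounds ltr01 _ fx) => z zx; rewrite -ler_norml.
  have xr : `|x r| <= `|x0|.
    rewrite -x00; apply: (off_zero_solution_norm bD (is_solution_off_zero sx)) => //.
    exact: ltW.
  apply: le_trans (@field_bound Delta r _ _ _ zx xr) _.
  by rewrite /K (ger0_norm zeta0) lerD2l bD // ltW.
have h1 : x t - x s <= K * (t - s).
  apply: abs_continuous_le => //.
  by apply: ae_impl dK => r H sr rt; have [? /andP[]] := H sr rt.
have h2 : (- x t) - (- x s) <= K * (t - s).
  apply: (@abs_continuous_le _ (fun t => - x t)) => //.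
    exact: abs_continuousN.
  apply: ae_impl dK => r H sr rt; have [dx /andP[h _]] := H sr rt.
  have [d1 d2] := is_deriveN (derivableP dx).
  by split => //; rewrite derive1E [X in X <= _]d2 -derive1E; lra.
by rewrite ler_norml; lra.
Qed.

End FilippovField.

(** * Stability and settling time *)

Section Stability.
Context {R : realType}.
Local Notation mu := (@lebesgue_measure R).
Variables (g : R -> R) (zeta : R).
Hypotheses (cg : continuous g) (g0 : g 0 = 0) (eg : forall x, g (- x) = g x).
Hypotheses (ndg : forall x y, 0 <= x -> x <= y -> g x <= g y).
Variable Delta : R -> R.
Hypotheses (bD : forall t, 0 <= t -> `|Delta t| <= zeta) (mD : borel_off_null Delta).
Implicit Types (x : R -> R) (s t y z L : R) (tau : \bar R).
Local Notation field := (field g zeta).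

Lemma filippov_field t y l : `|Delta t| <= zeta ->
  (y != 0 -> l = field Delta t y) -> (y = 0 -> l = 0) ->
  filippov (field Delta) t y l.
Proof.
move=> bt yn y0; have [/[dup] yE /y0 ->|yN] := eqVneq y 0.
  by rewrite yE; exact: filippov_field0.
by rewrite yn //; apply: filippov_value; exact: field_continuous.
Qed.

(** Starting at an arbitrary time s, so as to continue a solution from the end of
   its interval of definition. *)
Definition forward_trajectory s L x := [/\ x s = L,
  exists K, forall t1 t2, s <= t1 -> t1 <= t2 -> `|x t2 - x t1| <= K * (t2 - t1) &
  {ae mu, forall t, s < t ->
     derivable x t 1 /\ filippov (field Delta) t (x t) (x^`()%classic t)}].

Lemma forward_trajectory_exists s L : 0 <= s -> exists x, forward_trajectory s L x.
Proof.
move=> s0; have [L0|/ltW L0] := leP 0 L.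
  have [x [K [xs lipx aex]]] := nonneg_trajectory cg g0 ndg mD bD s0 L0.
  exists x; split; [by []|by exists K|].
  apply: ae_impl aex => t H st; have [xt [d1 d2]] := H st.
  split => //; rewrite derive1E d2; apply: filippov_field; first by apply: bD; lra.
    move=> xtn; have xt0 : 0 < x t by rewrite lt_neqAle eq_sym xtn.
    by rewrite xt0 field_gt0.
  by move=> ->; rewrite ltxx.
have bDN t : 0 <= t -> `|- Delta t| <= zeta by rewrite normrN; exact: bD.
have LN0 : 0 <= - L by rewrite oppr_ge0.
have [x [K [xs lipx aex]]] := nonneg_trajectory cg g0 ndg (borel_off_nullN mD) bDN s0 LN0.
exists (fun t => - x t); split; first by rewrite xs opprK.
  by exists K => t1 t2 st1 t12; rewrite -opprD normrN; exact: lipx.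
apply: ae_impl aex => t H st; have [xt dx] := H st.
have [d1 d2] := is_deriveN dx.
split; first exact: d1.
rewrite derive1E [X in filippov _ _ _ X]d2; apply: filippov_field.
- by apply: bD; lra.
- rewrite oppr_eq0 => xtn; have xt0 : 0 < x t by rewrite lt_neqAle eq_sym xtn.
  rewrite xt0 -(opprK (field _ _ _)) -fieldN // opprK field_gt0 //.
- by move/eqP; rewrite oppr_eq0 => /eqP ->; rewrite ltxx oppr0.
Qed.

Lemma solution_exists (x0 : R) : exists x, is_solution (field Delta) x0 +oo x.
Proof.
have [x [xs [K lipx] aex]] := forward_trajectory_exists x0 (lexx 0).
exists x; split => //.
- move=> b b0 _; apply: (@lipschitz_abs_continuous _ _ K) => s t s0 st _.
  exact: lipx.
- by apply: ae_impl aex => t H t0 _; exact: H.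
Qed.

(** Solutions are Lipschitz, hence have a limit at a finite right endpoint,
   from which a forward trajectory takes over. *)
Lemma solution_extends (x0 : R) tau x : is_solution (field Delta) x0 tau x ->
  exists2 y, is_solution (field Delta) x0 +oo y &
    forall t, 0 <= t -> (t%:E < tau)%E -> y t = x t.
Proof.
case: tau => [T| |] sx; last 2 first.
- by exists x.
- by case: sx.
have [T0 x00 acx aex] := sx; rewrite lte_fin in T0.
have lipx s t : 0 <= s -> s <= t -> t < T ->
    `|x t - x s| <= (g (`|x0| + 1) + zeta + zeta) * (t - s).
  by move=> s0 st tT; apply: (solution_lipschitz cg g0 eg ndg bD sx) => //.
set K := _ + _ + _ in lipx.
have K0 : 0 <= K.
  have := le_trans (normr_ge0 _) (lipx 0 (T / 2) (lexx 0) ltac:(lra) ltac:(lra)).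
  by rewrite subr0 pmulr_lge0 //; lra.
pose S := [set x t - K * (T - t) | t in `[0, T[%classic].
have cmp s t : 0 <= s < T -> 0 <= t < T -> x s - K * (T - s) <= x t + K * (T - t).
  move=> /andP[s0 sT] /andP[t0 tT].
  have h1 : 0 <= K * (T - s) by rewrite mulr_ge0 //; lra.
  have h2 : 0 <= K * (T - t) by rewrite mulr_ge0 //; lra.
  have [st|/ltW ts] := leP s t.
    by have := lipx s t s0 st tT; rewrite ler_norml; lra.
  by have := lipx t s t0 ts sT; rewrite ler_norml; lra.
(* The limit of x at T, given by its lower Lipschitz bounds. *)
pose l := sup S.
have lP t : 0 <= t < T -> `|l - x t| <= K * (T - t).
  move=> tT.
  have h1 : x t - K * (T - t) <= l.
    apply: ub_le_sup; last by exists t.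
    exists (x t + K * (T - t)) => _ [s /= sT <-].
    by apply: cmp => //; rewrite in_itv/= in sT.
  have h2 : l <= x t + K * (T - t).
    apply: ge_sup; first by exists (x t - K * (T - t)), t.
    by move=> _ [s /= sT <-]; apply: cmp => //; rewrite in_itv/= in sT.
  by rewrite ler_norml; lra.
have [z [zT [K2 lipz] aez]] := forward_trajectory_exists l (ltW T0).
pose y t := if t < T then x t else z t.
have yx t : t < T -> y t = x t by rewrite /y => ->.
have yz t : T <= t -> y t = z t by rewrite /y ltNge => ->.
exists y; last by move=> t _; rewrite lte_fin => /yx.
split => //.
- by rewrite yx.
- move=> b _ _; apply: (@lipschitz_abs_continuous _ _ (K + `|K2|)) => s t s0 st _.
  have K2n a b' : a <= b' -> K2 * (b' - a) <= `|K2| * (b' - a).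
    by move=> ab; rewrite ler_wpM2r ?ler_norm //; lra.
  have Kp a b' : a <= b' -> 0 <= K * (b' - a) by move=> ab; rewrite mulr_ge0 //; lra.
  have K2p a b' : a <= b' -> 0 <= `|K2| * (b' - a) by move=> ab; rewrite mulr_ge0 //; lra.
  rewrite mulrDl.
  have [tT|Tt] := ltP t T.
    rewrite !yx //; last lra.
    by have := lipx s t s0 st tT; have := K2p _ _ st; lra.
  have [sT|Ts] := ltP s T.
    rewrite yz // yx //.
    have := lipz T t (lexx T) Tt; rewrite zT.
    have := lP s ltac:(lra).
    have := K2n _ _ Tt; have := Kp _ _ Tt; have := K2p _ _ (ltW sT).
    by rewrite !ler_norml; lra.
  rewrite !yz //.
  by have := lipz s t Ts st; have := K2n _ _ st; have := Kp _ _ st; lra.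
have aeT := negligible_ae (negligible_set1 T).
apply: ae_impl (ae_and (ae_and aex aez) aeT) => t [[Hx Hz] HT] t0 _.
have transfer (w : R -> R) : (\forall u \near t, w u = y u) -> w t = y t ->
    derivable w t 1 /\ filippov (field Delta) t (w t) (w^`()%classic t) ->
    derivable y t 1 /\ filippov (field Delta) t (y t) (y^`()%classic t).
  move=> wy wt [dw fw]; split; first exact: near_eq_derivable dw.
  by rewrite derive1E -(near_eq_derive _ wy) -derive1E -wt.
have [tT|Tt|tT] := ltgtP t T; last by case: HT.
  apply: (transfer x); [|by rewrite yx|by apply: Hx => //; rewrite lte_fin].
  by near=> u; rewrite yx //; near: u; exact: lt_nbhsl.
apply: (transfer z); [|by rewrite yz // ltW|exact: Hz].
by near=> u; rewrite yz // ltW //; near: u; exact: lt_nbhsr.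
Unshelve. all: by end_near. Qed.

Lemma field_forward_complete (x0 : R) : forward_complete (field Delta) x0.
Proof. by split; [exact: solution_exists|exact: solution_extends]. Qed.

Lemma solution_norm_nonincreasing (x0 : R) x s t : is_solution (field Delta) x0 +oo x ->
  0 <= s -> s <= t -> `|x t| <= `|x s|.
Proof.
move=> sx s0 st; apply: (off_zero_solution_norm g0 eg ndg bD) => //.
- exact: is_solution_off_zero sx.
- exact: ltry.
Qed.

(** As |x| is nonincreasing along every solution, eta = e witnesses Lyapunov
   stability, and a solution that has reached the origin stays there. *)
Lemma predefined_time_stable_of_reach Tc : 0 < Tc ->
  (forall (x0 : R) x, is_solution (field Delta) x0 +oo x -> x Tc = 0) ->
  predefined_time_stable (field Delta) Tc.
Proof.
move=> Tc0 reach.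
have settled (x0 : R) : settled_after (field Delta) x0 Tc.
  split; first exact: ltW.
  move=> x sx t Tt; have := solution_norm_nonincreasing sx (ltW Tc0) Tt.
  by rewrite (reach _ _ sx) normr0 normr_le0 => /eqP.
have settling (x0 : R) : (settling_time (field Delta) x0 <= Tc%:E)%E.
  by apply: ereal_inf_lbound; exists Tc.
split => //; split; last by exists Tc.
split; last by move=> x0; split; [exact: field_forward_complete|exists Tc].
move=> e e0; exists e => // x0 x0e; split; first exact: field_forward_complete.
move=> x sx t t0; apply: le_lt_trans (solution_norm_nonincreasing sx (lexx 0) t0) _.
by have [_ -> _ _] := sx.
Qed.

End Stability.

Section ReachingTime.
Context {R : realType}.
Local Notation mu := (@lebesgue_measure R).
Variables (g : R -> R) (zeta : R).
Hypotheses (cg : continuous g) (g0 : g 0 = 0) (eg : forall x, g (- x) = g x).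
Hypotheses (ndg : forall x y, 0 <= x -> x <= y -> g x <= g y).
Hypothesis g_gt0 : forall x, 0 < x -> 0 < g x.
Variables (Phi : R -> R) (Tc : R).
Hypothesis Tc0 : 0 < Tc.
Hypothesis PhiP : forall x : R, 0 < x -> 0 <= Phi x < Tc /\ is_derive x 1 Phi (g x)^-1.
Implicit Types (Delta x : R -> R).

(** Along a solution that is still positive at time Tc, the remaining time Phi
   would decrease at rate at least 1 on [0, Tc] while staying in [0, Tc[. *)
Lemma off_zero_solution_reach Delta x :
  (forall t, 0 <= t -> `|Delta t| <= zeta) ->
  off_zero_solution g zeta Delta +oo x -> x Tc <= 0.
Proof.
move=> bD sx; rewrite leNgt; apply/negP => xT0.
have le_x s t : 0 <= s -> s <= t -> t <= Tc -> x t <= x s /\ x Tc <= x t.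
  move=> s0 st tT.
  have h1 := off_zero_solution_le g0 eg ndg bD sx (le_trans s0 st) tT (ltry _).
  have h2 := off_zero_solution_le g0 eg ndg bD sx s0 st (ltry _).
  have h3 : x Tc <= x t by move: h1; rewrite le_max => /orP[//|]; lra.
  by split => //; move: h2; rewrite le_max => /orP[//|]; lra.
have xpos t : 0 <= t -> t <= Tc -> 0 < x t.
  by move=> t0 tT; have [_] := le_x t t t0 (lexx t) tT; lra.
have gT : 0 < g (x Tc) by exact: g_gt0.
have lipPhi a b : x Tc <= a -> a <= b -> `|Phi b - Phi a| <= (g (x Tc))^-1 * (b - a).
  move=> Ta ab.
  have ca : {within `[a, b], continuous Phi}.
    apply: continuous_pos_within => t; last first.
      move=> t0; apply: differentiable_continuous; apply/derivable1_diffP.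
      by have [_ []] := PhiP t0.
    by rewrite /= in_itv/= => /andP[+ _]; lra.
  have [t|c] := @MVT_segment _ Phi (fun t => (g t)^-1) a b ab _ ca.
    by rewrite in_itv/= => /andP[at_ _]; have [] := PhiP (_ : 0 < t) => //; lra.
  rewrite in_itv/= => /andP[ac cb] ->.
  have gc : g (x Tc) <= g c by apply: ndg; lra.
  have gc0 : 0 < g c by apply: g_gt0; lra.
  rewrite ger0_norm ?mulr_ge0 ?invr_ge0 ?(ltW gc0) //; last lra.
  by rewrite ler_wpM2r ?lef_pV2 ?posrE //; lra.
have [acx aex] := sx.
have acf : abs_continuous 0 Tc (fun t => Phi (x t)).
  move=> e e0.
  have [d d0 H] := acx Tc (ltW Tc0) (ltry _) (e * g (x Tc)) (mulr_gt0 e0 gT).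
  exists d => // n u v h1 h2 h3; have := H n u v h1 h2 h3.
  rewrite -ltr_pdivrMr //; apply: le_lt_trans; rewrite mulr_suml.
  apply: ler_sum => i _; have [ui [uvi vi]] := h1 i.
  have [h4 h5] := le_x _ _ ui uvi vi.
  rewrite distrC; apply: le_trans (lipPhi _ _ h5 h4) _.
  by rewrite distrC ger0_norm ?subr_ge0 // mulrC.
have : Phi (x Tc) - Phi (x 0) <= - 1 * (Tc - 0).
  apply: (@abs_continuous_le _ (fun t => Phi (x t))) => //; first exact: ltW.
  apply: ae_impl aex => t H t0 tT.
  have xt := xpos t (ltW t0) (ltW tT).
  have dx := H t0 (ltry _) (lt0r_neq0 xt).
  have [_ dPhi] := PhiP xt.
  have [d1 d2] := is_derive1_comp dPhi dx.
  split; first exact: d1.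
  rewrite derive1E [X in X <= _]d2 field_gt0 //.
  rewrite mulrC ler_pdivrMr ?g_gt0 //.
  by have := bD t (ltW t0); rewrite ler_norml; lra.
have [/andP[h1 _] _] := PhiP xT0.
have [/andP[_ h2] _] := PhiP (xpos 0 (lexx 0) (ltW Tc0)).
by lra.
Qed.

Lemma solution_reach Delta (x0 : R) x : (forall t, 0 <= t -> `|Delta t| <= zeta) ->
  is_solution (field g zeta Delta) x0 +oo x -> x Tc = 0.
Proof.
move=> bD /(is_solution_off_zero cg) sx.
have h1 := off_zero_solution_reach bD sx.
have bDN t : 0 <= t -> `|- Delta t| <= zeta by rewrite normrN; exact: bD.
have h2 := off_zero_solution_reach bDN (off_zero_solutionN eg sx).
by apply/eqP; rewrite eq_le h1 -oppr_le0.
Qed.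

End ReachingTime.

(** * The feedback law *)

Section Feedback.
Context {R : realType}.

Lemma powR_norm_continuous (p : R) : 0 < p -> continuous (fun x : R => `|x| `^ p).
Proof.
move=> p0 x; have [->|x0] := eqVneq x 0; last first.
  apply: (@continuous_comp _ _ _ (fun x : R => `|x|) (fun y => y `^ p)).
    exact: norm_continuous.
  by apply: powR_continuous_pos; rewrite normr_gt0.
apply/cvgrPdist_lt => e e0; rewrite normr0 powR0 ?lt0r_neq0 //.
apply/nbhs_ballP; exists (e `^ p^-1) => /=; first exact: powR_gt0.
move=> y; rewrite /ball/= !sub0r !normrN (ger0_norm (powR_ge0 _ _)) => ye.
have -> : e = (e `^ p^-1) `^ p by rewrite -powRrM mulVf ?lt0r_neq0 // powRr1 // ltW.
by rewrite gt0_ltr_powR // ?nnegrE ?powR_ge0.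
Qed.

Variables alpha beta p q k : R.
Hypotheses (halpha : 0 < alpha) (hbeta : 0 < beta).
Hypotheses (hp : 0 < p) (hq : 0 < q) (hk : 0 < k).

Let g (x : R) := (alpha * `|x| `^ p + beta * `|x| `^ q) `^ k.

Let base_ge0 (x : R) : 0 <= alpha * `|x| `^ p + beta * `|x| `^ q.
Proof. by rewrite addr_ge0 // mulr_ge0 ?powR_ge0 // ltW. Qed.

Lemma feedback_continuous : continuous g.
Proof.
have cb : continuous (fun x : R => alpha * `|x| `^ p + beta * `|x| `^ q).
  move=> x; apply: cvgD; (apply: cvgM; first exact: cvg_cst).
    exact: powR_norm_continuous.
  exact: powR_norm_continuous.
rewrite (_ : g = (fun y => `|y| `^ k) \o (fun x => alpha * `|x| `^ p + beta * `|x| `^ q)).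
  by move=> x; apply: (continuous_comp (cb x)); exact: powR_norm_continuous.
by apply/funext => x; rewrite /g /= (ger0_norm (base_ge0 x)).
Qed.

Lemma feedback0 : g 0 = 0.
Proof.
by rewrite /g normr0 !powR0 ?lt0r_neq0 // !mulr0 addr0 powR0 // lt0r_neq0.
Qed.

Lemma feedback_gt0 (x : R) : 0 < x -> 0 < g x.
Proof.
move=> x0; rewrite /g powR_gt0 // gtr0_norm //.
by rewrite addr_gt0 // mulr_gt0 // powR_gt0.
Qed.

Lemma feedback_nondecreasing (x y : R) : 0 <= x -> x <= y -> g x <= g y.
Proof.
move=> x0 xy; have y0 : 0 <= y by exact: le_trans xy.
have mono r : 0 < r -> `|x| `^ r <= `|y| `^ r.
  move=> r0; apply: ge0_ler_powR; rewrite ?nnegrE ?(ltW r0) //.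
  by rewrite !ger0_norm.
apply: ge0_ler_powR; rewrite ?nnegrE ?base_ge0 ?(ltW hk) //.
by rewrite lerD // ler_pM2l // mono.
Qed.

End Feedback.

Theorem theorem3 (R : realType) (delta : R) (Delta : R -> R)
    (alpha beta p q k Tc zeta : R)
    (hdelta : 0 <= delta)
    (mDelta : lebesgue_measurable_fun `[0, +oo[ Delta)
    (hDelta : forall t, 0 <= t -> `|Delta t| <= delta)
    (halpha : 0 < alpha) (hbeta : 0 < beta)
    (hp : 0 < p) (hq : 0 < q) (hk : 0 < k)
    (hkp : k * p < 1) (hkq : 1 < k * q)
    (hTc : 0 < Tc) (hzeta : delta <= zeta) :
  let mp := (1 - k * p) / (q - p) in
  let mq := (k * q - 1) / (q - p) in
  let gamma := Gamma mp * Gamma mq / (alpha `^ k * Gamma k * (q - p))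
               * (alpha / beta) `^ mp in
  let u := fun x : R =>
    - (gamma / Tc * (alpha * `|x| `^ p + beta * `|x| `^ q) `^ k + zeta)
    * Num.sg x in
  predefined_time_stable (fun t x => u x + Delta t) Tc.
Proof.
move=> mp mq gamma u.
have [Phi PhiP] := settling_time_function halpha hbeta hk hkp hkq.
rewrite -/mp -/mq -/gamma in PhiP.
have gamma0 : 0 < gamma by have [/andP[h1 h2] _] := PhiP 1 ltr01; lra.
have c0 : 0 < gamma / Tc by rewrite divr_gt0.
pose g (x : R) := gamma / Tc * (alpha * `|x| `^ p + beta * `|x| `^ q) `^ k.
have cg : continuous g.
  by move=> x; apply: cvgM; [exact: cvg_cst|exact: feedback_continuous].
have g0 : g 0 = 0 by rewrite /g feedback0 ?mulr0.
have eg x : g (- x) = g x by rewrite /g normrN.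
have ndg (x y : R) : 0 <= x -> x <= y -> g x <= g y.
  move=> x0 xy; apply: ler_wpM2l; first exact: ltW.
  exact: feedback_nondecreasing.
have g_gt0 x : 0 < x -> 0 < g x by move=> x0; rewrite mulr_gt0 // feedback_gt0.
have bD t : 0 <= t -> `|Delta t| <= zeta.
  by move=> t0; apply: le_trans hzeta; exact: hDelta.
apply: (predefined_time_stable_of_reach cg g0 eg ndg bD) => //.
  exact: lebesgue_measurable_borel.
move=> x0 x sx.
apply: (@solution_reach _ g zeta cg g0 eg ndg g_gt0 (fun x => (gamma / Tc)^-1 * Phi x) Tc hTc _ Delta x0) => //.
move=> y y0; have [/andP[h1 h2] dPhi] := PhiP y y0; split.
  rewrite mulr_ge0 ?invr_ge0 ?(ltW c0) //=.
  by rewrite mulrC ltr_pdivrMr // mulrC divfK // lt0r_neq0.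
apply: (is_derive_eq (is_deriveZ (gamma / Tc)^-1 dPhi)).
by rewrite /GRing.scale/= /g gtr0_norm // [RHS]invfM.
Qed.
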